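(* The theory $\widehat T$ (the theory of the generic meet tree with a circular order on the open cones above each point, with one constant named) is monadically NIP and distal.
   Context: A meet tree is a structure $(T,\leq,\wedge)$ where $\leq$ is a partial order such that for every $x$ the set $\{y:y\leq x\}$ is linearly ordered, and for all $x,y$ the set $\{z:z\leq x,y\}$ has a greatest element $x\wedge y$. For $a,b>c$ write $a\sim_c b$ if $a\wedge b>c$; this is an equivalence relation on $\{a:a>c\}$ whose classes are the open cones above $c$. Let $L^*=\{\leq,\wedge,C^*(x,y_1,y_2,y_3)\}$ and let $T^*_\forall$ be the $L^*$-theory consisting of the axioms of meet trees together with: (i) if $C^*(x,y_0,y_1,y_2)$ and $y_i\sim_x y_i'$ for $i<3$, then $C^*(x,y_0',y_1',y_2')$; (ii) $C^*(x,y_0,y_1,y_2)$ implies $x<y_i$ for $i<3$; (iii) for every $x$, $C^*(x,-,-,-)$ induces a (strict) circular order on the set of open cones above $x$. The finite models of $T^*_\forall$ form a uniformly locally finite Fraïssé class; let $T^*$ be the theory of its Fraïssé limit (it is $\omega$-categorical, NIP, has quantifier elimination, and is the model completion of $T^*_\forall$). Choose a model $M\models T^*$ and any element $r\in M$, and let $\widehat T:=\operatorname{Th}(M,r)$ in the language $\widehat L=\{\leq,\wedge,C^*,r\}$ with $r$ a constant symbol. A theory is monadically NIP if every expansion of every model by unary predicates is NIP. A NIP theory is distal if, whenever $I+b+J$ is an indiscernible sequence with $I,J$ dense without endpoints and $I+J$ is indiscernible over a set $A$, then $I+b+J$ is indiscernible over $A$. *)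

(* Defs.v *)
From mathcomp Require Import all_boot.
From mathcomp Require Import boolp classical_sets functions cardinality.

Set Implicit Arguments.
Unset Strict Implicit.
Unset Printing Implicit Defensive.

Local Open Scope classical_set_scope.

(** * First-order logic *)

Record language := Language {
  fsym : Type;
  farity : fsym -> nat;
  rsym : Type;
  rarity : rsym -> nat }.

(* Terms and formulas have their free variables in an arbitrary type [V];
   a quantifier binds the variable [None] of [option V].  Thus [formula L void]
   is the type of sentences and [formula L (X + Y)] that of formulas in two
   groups of variables. *)
Inductive term (L : language) (V : Type) : Type :=
| Var of V
| App (f : fsym L) of ('I_(farity f) -> term L V).

Inductive formula (L : language) (V : Type) : Type :=
| Bot
| Equal of term L V & term L V
| Rel (R : rsym L) of ('I_(rarity R) -> term L V)
| Imp of formula L V & formula L V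
| All of formula L (option V).

Record structure (L : language) := Structure {
  carrier :> Type;
  fint : forall f : fsym L, ('I_(farity f) -> carrier) -> carrier;
  rint : forall R : rsym L, ('I_(rarity R) -> carrier) -> Prop }.

Arguments fint {L} s f _.
Arguments rint {L} s R _.

Fixpoint eval (L : language) (M : structure L) (V : Type) (v : V -> M)
    (t : term L V) : M :=
  match t with
  | Var x => v x
  | App f ts => fint M f (fun i => eval v (ts i))
  end.

Definition extend (V M : Type) (v : V -> M) (a : M) : option V -> M :=
  fun o => if o is Some x then v x else a.

Fixpoint sat (L : language) (M : structure L) (V : Type) (phi : formula L V)
    : (V -> M) -> Prop :=
  match phi with
  | Bot => fun _ => False
  | Equal t u => fun v => eval v t = eval v u
  | Rel R ts => fun v => rint M R (fun i => eval v (ts i))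
  | Imp phi psi => fun v => sat phi v -> sat psi v
  | All phi => fun v => forall a : M, sat phi (extend v a)
  end.

Definition theory (L : language) := set (formula L void).

Definition holds (L : language) (M : structure L) (phi : formula L void) : Prop :=
  sat phi (of_void M).

Definition models (L : language) (M : structure L) (T : theory L) : Prop :=
  forall phi, T phi -> holds M phi.

Definition Th (L : language) (M : structure L) : theory L :=
  [set phi | holds M phi].

(** * Expansions *)

Definition with_const (L : language) : language :=
  {| fsym := option (fsym L);
     farity := fun o => if o is Some f then farity f else 0;
     rsym := rsym L;
     rarity := @rarity L |}.

Definition expand_const (L : language) (M : structure L) (r : M) :
    structure (with_const L) :=
  {| carrier := M;
     fint := fun o : fsym (with_const L) =>
       match o return ('I_(@farity (with_const L) o) -> M) -> M with
       | Some f => fint M f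
       | None => fun=> r
       end;
     rint := fun R : rsym (with_const L) => rint M (R : rsym L) |}.

Definition with_preds (L : language) (P : Type) : language :=
  {| fsym := fsym L;
     farity := @farity L;
     rsym := rsym L + P;
     rarity := fun R => match R with inl R => rarity R | inr _ => 1 end |}.

Definition expand_preds (L : language) (M : structure L) (P : Type)
    (U : P -> set M) : structure (with_preds L P) :=
  {| carrier := M;
     fint := fun f : fsym (with_preds L P) => fint M (f : fsym L);
     rint := fun R : rsym (with_preds L P) =>
       match R return ('I_(@rarity (with_preds L P) R) -> M) -> Prop with
       | inl R => rint M R
       | inr p => fun x => U p (x ord0)
       end |}.

(** * NIP and monadic NIP *)

Definition join (X Y M : Type) (a : X -> M) (b : Y -> M) : X + Y -> M :=
  fun z => match z with inl x => a x | inr y => b y end.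

Definition has_IP (L : language) (T : theory L) (p q : nat)
    (phi : formula L ('I_p + 'I_q)) : Prop :=
  exists M : structure L, models M T /\
    exists (a : nat -> 'I_p -> M) (b : set nat -> 'I_q -> M),
      forall (i : nat) (S : set nat), sat phi (join (a i) (b S)) <-> S i.

Definition NIP (L : language) (T : theory L) : Prop :=
  forall (p q : nat) (phi : formula L ('I_p + 'I_q)), ~ has_IP T phi.

Definition monadically_NIP (L : language) (T : theory L) : Prop :=
  forall M : structure L, models M T ->
  forall (P : Type) (U : P -> set M), NIP (Th (expand_preds U)).

(** * Indiscernible sequences and distality *)

Record strict_linear_order (I : Type) (lt : I -> I -> Prop) : Prop := {
  slo_irrefl : forall i, ~ lt i i;
  slo_trans : forall i j k, lt i j -> lt j k -> lt i k;
  slo_total : forall i j, [\/ lt i j, i = j | lt j i] }.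

(* Nonemptiness is needed: with empty sides allowed, not even the theory of
   dense linear orders would be distal. *)
Record dense_without_endpoints (I : Type) (lt : I -> I -> Prop) : Prop := {
  dwe_linear : strict_linear_order lt;
  dwe_nonempty : inhabited I;
  dwe_dense : forall i j, lt i j -> exists k, lt i k /\ lt k j;
  dwe_no_min : forall i, exists j, lt j i;
  dwe_no_max : forall i, exists j, lt i j }.

(* The order of the concatenation I + J. *)
Definition lt_cat (I J : Type) (ltI : I -> I -> Prop) (ltJ : J -> J -> Prop)
    (x y : I + J) : Prop :=
  match x, y with
  | inl i, inl i' => ltI i i'
  | inl _, inr _ => True
  | inr _, inl _ => False
  | inr j, inr j' => ltJ j j'
  end.

Definition lt_unit (_ _ : unit) : Prop := False.

Definition increasing (I : Type) (lt : I -> I -> Prop) (n : nat)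
    (i : 'I_n -> I) : Prop :=
  forall k l : 'I_n, k < l -> lt (i k) (i l).

(* [s] is a sequence of [m]-tuples of [M], indexed by the order [(I, lt)]. *)
Definition indiscernible_over (L : language) (M : structure L) (A : set M)
    (I : Type) (lt : I -> I -> Prop) (m : nat) (s : I -> 'I_m -> M) : Prop :=
  forall (n q : nat) (phi : formula L ('I_n * 'I_m + 'I_q))
         (i j : 'I_n -> I) (c : 'I_q -> M),
    increasing lt i -> increasing lt j -> (forall k, A (c k)) ->
    sat phi (join (fun kl => s (i kl.1) kl.2) c) <->
    sat phi (join (fun kl => s (j kl.1) kl.2) c).

Definition distal (L : language) (T : theory L) : Prop :=
  NIP T /\
  forall M : structure L, models M T ->
  forall (I J : Type) (ltI : I -> I -> Prop) (ltJ : J -> J -> Prop),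
    dense_without_endpoints ltI -> dense_without_endpoints ltJ ->
  forall (m : nat) (a : I -> 'I_m -> M) (b : 'I_m -> M) (c : J -> 'I_m -> M)
         (A : set M),
    let lt_IbJ := lt_cat (lt_cat ltI lt_unit) ltJ in
    let IbJ := join (join a (fun _ : unit => b)) c in
    indiscernible_over set0 lt_IbJ IbJ ->
    indiscernible_over A (lt_cat ltI ltJ) (join a c) ->
    indiscernible_over A lt_IbJ IbJ.

(** * Fraisse limits *)

Record embedding (L : language) (M N : structure L) (h : M -> N) : Prop := {
  emb_inj : injective h;
  emb_fun : forall (f : fsym L) (x : 'I_(farity f) -> M),
    h (fint M f x) = fint N f (h \o x);
  emb_rel : forall (R : rsym L) (x : 'I_(rarity R) -> M),
    rint M R x <-> rint N R (h \o x) }.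

Definition automorphism (L : language) (M : structure L) (h : M -> M) : Prop :=
  embedding h /\ bijective h.

Definition closed_under_functions (L : language) (M : structure L)
    (S : set M) : Prop :=
  forall (f : fsym L) (x : 'I_(farity f) -> M),
    (forall i, S (x i)) -> S (fint M f x).

Definition finitely_generated (L : language) (M : structure L) : Prop :=
  exists2 G : set M, finite_set G &
    forall S : set M, G `<=` S -> closed_under_functions S -> S = setT.

Definition age (L : language) (F : structure L) : set (structure L) :=
  [set A : structure L | finitely_generated A /\ exists h : A -> F, embedding h].

Definition ultrahomogeneous (L : language) (F : structure L) : Prop :=
  forall A : structure L, finitely_generated A ->
  forall g h : A -> F, embedding g -> embedding h ->
  exists2 sigma : F -> F, automorphism sigma & forall x, sigma (g x) = h x.

Record fraisse_limit (L : language) (K : set (structure L)) (F : structure L)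
    : Prop := {
  fl_countable : countable [set: F];
  fl_age : age F = K;
  fl_homogeneous : ultrahomogeneous F }.

(** * Meet trees with a circular order on the open cones *)

Inductive Lstar_fsym := Meet.
Inductive Lstar_rsym := Le | Cstar.

Definition Lstar : language :=
  {| fsym := Lstar_fsym;
     farity := fun=> 2;
     rsym := Lstar_rsym;
     rarity := fun R => match R with Le => 2 | Cstar => 4 end |}.

Section MeetTrees.
Variable M : structure Lstar.
Implicit Types x y a b c : M.

Definition le x y : Prop := rint M (Le : rsym Lstar) (tnth [tuple x; y]).
Definition lt x y : Prop := le x y /\ x <> y.
Definition meet x y : M := fint M (Meet : fsym Lstar) (tnth [tuple x; y]).
Definition C x y0 y1 y2 : Prop :=
  rint M (Cstar : rsym Lstar) (tnth [tuple x; y0; y1; y2]).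

Record meet_tree : Prop := {
  mt_refl : forall x, le x x;
  mt_antisym : forall x y, le x y -> le y x -> x = y;
  mt_trans : forall x y z, le x y -> le y z -> le x z;
  mt_linear : forall x y z, le y x -> le z x -> le y z \/ le z y;
  mt_meet_lb : forall x y, le (meet x y) x /\ le (meet x y) y;
  mt_meet_max : forall x y z, le z x -> le z y -> le z (meet x y) }.

Definition same_cone c a b : Prop := [/\ lt c a, lt c b & lt c (meet a b)].

Definition open_cones c : set (set M) :=
  [set [set b | same_cone c a b] | a in [set a | lt c a]].

Definition C_cones x (K0 K1 K2 : set M) : Prop :=
  exists y0 y1 y2, [/\ K0 y0, K1 y1, K2 y2 & C x y0 y1 y2].

End MeetTrees.

Record strict_circular_order_on (X : Type) (D : set X)
    (R : X -> X -> X -> Prop) : Prop := {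
  sco_cyclic : forall a b c, D a -> D b -> D c -> R a b c -> R b c a;
  sco_asym : forall a b c, D a -> D b -> D c -> R a b c -> ~ R c b a;
  sco_trans : forall a b c d, D a -> D b -> D c -> D d ->
    R a b c -> R a c d -> R a b d;
  sco_total : forall a b c, D a -> D b -> D c ->
    a <> b -> b <> c -> a <> c -> R a b c \/ R c b a }.

Record Tstar_forall (M : structure Lstar) : Prop := {
  ts_meet_tree : meet_tree M;
  ts_invariant : forall x y0 y1 y2 y0' y1' y2' : M, C x y0 y1 y2 ->
    same_cone x y0 y0' -> same_cone x y1 y1' -> same_cone x y2 y2' ->
    C x y0' y1' y2';
  ts_above : forall x y0 y1 y2 : M, C x y0 y1 y2 ->
    [/\ lt x y0, lt x y1 & lt x y2];
  ts_circular : forall x : M,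
    strict_circular_order_on (open_cones x) (C_cones x) }.

Definition finite_models_Tstar_forall : set (structure Lstar) :=
  [set A : structure Lstar | finite_set [set: A] /\ Tstar_forall A].

Definition That (M : structure Lstar) (r : M) : theory (with_const Lstar) :=
  Th (expand_const r).

(* Main.v *)
From mathcomp Require Import all_boot zify.
From mathcomp Require Import boolp classical_sets functions cardinality.
From Stdlib Require List.
Require Import Defs.

Set Implicit Arguments.
Unset Strict Implicit.
Unset Printing Implicit Defensive.

Local Open Scope classical_set_scope.

(** Every structure [N] in sight is a meet tree with circular orders on its open
    cones: these axioms are universal, so they pass from the finite models to
    the Fraisse limit, and then, being first-order, to every model
    ([fraisse_limit_circ_tree], [axiomsP]).  The argument is about all such trees.

    Tuples are compared by Ehrenfeucht-Fraisse games on [N], coloured by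
    finitely many of the unary predicates and by the named constant: [ef] is
    equivalence up to a given number of rounds.  Every formula is invariant
    under some [ef] ([formula_invariant]), and each [ef] has finitely many
    classes, all of them definable ([ef_finite_index]).

    The geometry is in one observation.  Call region a set {z | z >= c} or an
    arc {z | C(c,a,z,b)}.  What an element outside a region sees of it hardly
    depends on the elements inside, so two games, one with the elements inside
    and one with those outside, combine into one game with all of them ([glue]).
    In consequence ([ef_replace]), if two tuples x and x' look the same over
    parameters s, and regions with parameters in s separate the entries of x
    from those of b, then x and x' look the same over b.

    Such regions exist around the entries of a homogeneous sequence.  A sequence
    of elements that is homogeneous for triples is constant, or its meets
    increase, or decrease, or it runs around one point along the circular order
    ([classification]).  In the last three cases two terms before and two terms
    after z_i bound a gap that contains z_i, and gaps of disjoint blocks of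
    indices are disjoint.

    Monadic NIP: given a tuple sequence shattered by a formula, the theorem of
    Ramsey makes it homogeneous for [ef].  The entries of a parameter tuple b
    fall in a bounded number of gaps, so some block of indices has gaps free of
    b, and over b the formula cannot tell apart two consecutive terms in the
    middle of this block.  It therefore cannot hold at every other term only.

    Distality: around the cut, the gaps bounded by terms of I and J close to b
    contain b and a neighbour of b in I.  They contain no element of A and no
    other term, since by indiscernibility such an element would lie in the gap
    of another, disjoint block as well.  Hence b and its neighbour are
    interchangeable over A and the other terms. *)

(** * Meet trees with a circular order on the open cones, element by element *)

(** The circular orders are given on the elements above a point rather than on
    its cones, so that every axiom is a universal first-order sentence. *)
Record circ_tree (X : structure Lstar) : Prop := {
  ct_tree :> meet_tree X;
  C_inv1 : forall x a a' b c : X,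
    same_cone x a a' -> C x a b c -> C x a' b c;
  ct_above : forall x a b c : X, C x a b c -> lt x a;
  C_rot : forall x a b c : X, C x a b c -> C x b c a;
  ct_asym : forall x a b c : X, C x a b c -> ~ C x c b a;
  ct_trans : forall x a b c d : X, C x a b c -> C x a c d -> C x a b d;
  ct_total : forall x a b c : X, lt x a -> lt x b -> lt x c ->
    ~ same_cone x a b -> ~ same_cone x b c -> ~ same_cone x a c ->
    C x a b c \/ C x c b a }.

Section MeetTree.
Variables (X : structure Lstar) (tree : meet_tree X).
Implicit Types x y z a b c : X.

Lemma le_refl x : le x x. Proof. exact: mt_refl. Qed.

Lemma le_trans y x z : le x y -> le y z -> le x z.
Proof. exact: mt_trans. Qed.

Lemma le_anti x y : le x y -> le y x -> x = y.
Proof. exact: mt_antisym. Qed.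

Lemma le_linear x y z : le y x -> le z x -> le y z \/ le z y.
Proof. exact: mt_linear. Qed.

Lemma meetl x y : le (meet x y) x. Proof. by case: (mt_meet_lb tree x y). Qed.

Lemma meetr x y : le (meet x y) y. Proof. by case: (mt_meet_lb tree x y). Qed.

Lemma le_meet x y z : le z x -> le z y -> le z (meet x y).
Proof. exact: mt_meet_max. Qed.

Lemma meetC x y : meet x y = meet y x.
Proof. by apply: le_anti; apply: le_meet; solve [exact: meetl | exact: meetr]. Qed.

Lemma meetxx x : meet x x = x.
Proof. apply: le_anti; [exact: meetl | apply: le_meet; exact: le_refl]. Qed.

Lemma lt_le_trans y x z : lt x y -> le y z -> lt x z.
Proof.
move=> [xy nxy] yz; split; first exact: le_trans yz.
by move=> xz; apply: nxy; apply: le_anti => //; rewrite xz.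
Qed.

Lemma lt_nle x y : lt x y -> ~ le y x.
Proof. by case=> xy nxy yx; apply: nxy; apply: le_anti. Qed.

Lemma lt_irrefl x : ~ lt x x. Proof. by case. Qed.

(** *** Open cones *)

Lemma cone_sym x a b : same_cone x a b -> same_cone x b a.
Proof. by case=> ? ? ?; split; rewrite // meetC. Qed.

Lemma cone_refl x a : lt x a -> same_cone x a a.
Proof. by move=> xa; split; rewrite // meetxx. Qed.

Lemma cone_above x y a b : lt x y -> le y a -> le y b -> same_cone x a b.
Proof.
move=> xy ya yb; split; [exact: lt_le_trans ya | exact: lt_le_trans yb |].
by apply: lt_le_trans xy _; apply: le_meet.
Qed.

Lemma cone_trans x b a c : same_cone x a b -> same_cone x b c -> same_cone x a c.
Proof.
move=> [xa xb xab] [_ xc xbc].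
have [h|h] := le_linear (meetr a b) (meetl b c).
- apply: (cone_above xab); first exact: meetl.
  by apply: le_trans h _; exact: meetr.
- apply: (cone_above xbc); last exact: meetr.
  by apply: le_trans h _; exact: meetl.
Qed.

End MeetTree.

Section CircTree.
Variables (X : structure Lstar) (hX : circ_tree X).
Implicit Types x y z a b c d : X.

Lemma C_above x a b c : C x a b c -> [/\ lt x a, lt x b & lt x c].
Proof.
move=> h; split; first exact: (ct_above hX h).
- exact: (ct_above hX (C_rot hX h)).
- exact: (ct_above hX (C_rot hX (C_rot hX h))).
Qed.

Lemma C_inv x a a' b b' c c' : same_cone x a a' -> same_cone x b b' ->
  same_cone x c c' -> C x a b c -> C x a' b' c'.
Proof.
move=> ha hb hc /(C_inv1 hX ha)/(C_rot hX)/(C_inv1 hX hb)/(C_rot hX)/(C_inv1 hX hc)/(C_rot hX).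
by [].
Qed.

Lemma C_neq x a b c : C x a b c -> ~ same_cone x a b.
Proof.
move=> h ab; have [xa xb xc] := C_above h.
have := C_inv (cone_refl hX xa) (cone_sym hX ab) (cone_refl hX xc) h.
by move=> /(C_rot hX) h'; exact: (ct_asym hX h' h').
Qed.

(** With [ct_trans] this gives all four triples of four points on the circle. *)
Lemma C_trans4 x a b c d : C x a b c -> C x a c d -> C x b c d.
Proof.
move=> /(C_rot hX)/(C_rot hX) h /(C_rot hX) h'.
by have /(C_rot hX)/(C_rot hX) := ct_trans hX h' h.
Qed.

Lemma C_asym x a b c : C x a b c -> ~ C x b a c.
Proof. by move=> /(ct_asym hX) h /(C_rot hX)/(C_rot hX). Qed.

Lemma C_total x a b c : lt x a -> lt x b -> lt x c ->
  ~ same_cone x a b -> ~ same_cone x b c -> ~ same_cone x a c ->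
  C x a b c \/ C x b a c.
Proof.
move=> xa xb xc ab bc ac; have [h|h] := ct_total hX xa xb xc ab bc ac.
- by left.
- by right; exact: C_rot h.
Qed.

End CircTree.

(** * Back-and-forth equivalence *)

Section EF.
Variables (X : structure Lstar) (Q : Type) (U : Q -> X -> Prop) (cs : seq Q).

Definition ef0 (V : Type) (v v' : V -> X) : Prop :=
  [/\ forall x y, le (v x) (v y) <-> le (v' x) (v' y),
      forall x y z w, C (v x) (v y) (v z) (v w) <-> C (v' x) (v' y) (v' z) (v' w) &
      forall q x, List.In q cs -> U q (v x) <-> U q (v' x)].

(** Asking for [ef k v v'] as well makes the rank monotone even when there is
    no element to play. *)
Fixpoint ef (k : nat) (V : Type) (v v' : V -> X) : Prop :=
  if k is k.+1 then
    [/\ ef k v v',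
        forall z, exists z', ef k (extend v z) (extend v' z') &
        forall z', exists z, ef k (extend v z) (extend v' z')]
  else ef0 v v'.

Lemma ef_refl k V (v : V -> X) : ef k v v.
Proof. by elim: k V v => [|k IH] V v; split=> // z; exists z. Qed.

Lemma ef_sym k V (v v' : V -> X) : ef k v v' -> ef k v' v.
Proof.
elim: k V v v' => [|k IH] V v v'.
  case=> h1 h2 h3; split=> *; apply: iff_sym;
    by [exact: h1 | exact: h2 | exact: h3].
case=> h1 h2 h3; split; first exact: IH.
- by move=> z; have [z' /IH h] := h3 z; exists z'.
- by move=> z; have [z' /IH h] := h2 z; exists z'.
Qed.

Lemma extend_comp (V W : Type) (f : W -> V) (v : V -> X) z :
  extend (v \o f) z = extend v z \o omap f.
Proof. by apply: funext => -[]. Qed.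

Lemma ef_comp k V W (f : W -> V) (v v' : V -> X) :
  ef k v v' -> ef k (v \o f) (v' \o f).
Proof.
elim: k V W f v v' => [|k IH] V W f v v'.
  by case=> h1 h2 h3; split=> *; [apply: h1 | apply: h2 | apply: h3].
case=> h1 h2 h3; split; first exact: IH.
- by move=> z; have [z' h] := h2 z; exists z'; rewrite (extend_comp f v) (extend_comp f v'); apply: IH.
- by move=> z; have [z' h] := h3 z; exists z'; rewrite (extend_comp f v) (extend_comp f v'); apply: IH.
Qed.

Lemma ef_reindex k V W (f : W -> V) (v v' : V -> X) (w w' : W -> X) :
  (forall x, w x = v (f x)) -> (forall x, w' x = v' (f x)) ->
  ef k v v' -> ef k w w'.
Proof.
move=> hw hw' /(ef_comp f).
have -> : w = v \o f by apply: funext.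
by have -> : w' = v' \o f by apply: funext.
Qed.

Lemma ef_ef0 k V (v v' : V -> X) : ef k v v' -> ef0 v v'.
Proof. by elim: k => [//|k IH] [/IH]. Qed.

Lemma ef_le k V (v v' : V -> X) x y :
  ef k v v' -> le (v x) (v y) -> le (v' x) (v' y).
Proof. by move=> /ef_ef0[h _ _] /h. Qed.

Lemma ef_C k V (v v' : V -> X) x y z w :
  ef k v v' -> C (v x) (v y) (v z) (v w) -> C (v' x) (v' y) (v' z) (v' w).
Proof. by move=> /ef_ef0[_ h _] /h. Qed.

Hypothesis hX : circ_tree X.

Lemma ef_eq k V (v v' : V -> X) x y : ef k v v' -> v x = v y -> v' x = v' y.
Proof.
move=> h e; apply: (le_anti hX); apply: (ef_le h); rewrite e; exact: (le_refl hX).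
Qed.

(** The meet is definable with one quantifier, so one round of the game lets
    either player add a meet of two elements already played. *)
Lemma ef_meet_val k V (v v' : V -> X) x y z :
  ef k.+1 v v' -> v z = meet (v x) (v y) -> v' z = meet (v' x) (v' y).
Proof.
move=> h e; have [_ _ back] := h; apply: (le_anti hX).
  by apply: (le_meet hX); apply: (ef_le h); rewrite e;
    [exact: (meetl hX) | exact: (meetr hX)].
have [w hw] := back (meet (v' x) (v' y)).
have hw' := ef_sym hw.
apply: (ef_le (x := None) (y := Some z) hw); rewrite /= e.
apply: (le_meet hX).
- by apply: (ef_le (x := None) (y := Some x) hw'); exact: (meetl hX).
- by apply: (ef_le (x := None) (y := Some y) hw'); exact: (meetr hX).
Qed.

Lemma ef_meet k V (v v' : V -> X) x y : ef k.+2 v v' ->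
  ef k.+1 (extend v (meet (v x) (v y))) (extend v' (meet (v' x) (v' y))).
Proof.
move=> [_ /(_ (meet (v x) (v y)))[z' h] _].
have -> // : meet (v' x) (v' y) = z'.
exact/esym/(ef_meet_val (x := Some x) (y := Some y) (z := None) h).
Qed.

(** All terms in the variables of [v]: a meet of several elements is the meet
    of two of them. *)
Definition pair_meets (V : Type) (v : V -> X) (x : V * V) : X := meet (v x.1) (v x.2).

(* Five rounds pay for the at most four meets that occur in one atomic formula
   about meets; a later move [z] is the meet of [z] with itself. *)
Lemma ef_meets k V (v v' : V -> X) : ef (k + 5) v v' -> ef k (pair_meets v) (pair_meets v').
Proof.
elim: k V v v' => [|k IH] V v v' h; last first.
  rewrite addSn in h; have [h1 h2 h3] := h.
  pose f (o : option (V * V)) := if o is Some (a, b) then (Some a, Some b) else (None : option V, None).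
  have red (u : V -> X) z x : extend (pair_meets u) z x = pair_meets (extend u z) (f x).
    by case: x => [[a b]|] //=; rewrite /pair_meets /= (meetxx hX).
  split; first exact: IH.
  - move=> z; have [z' /IH hz] := h2 z; exists z'.
    exact: ef_reindex (red v z) (red v' z') hz.
  - move=> z'; have [z /IH hz] := h3 z'; exists z.
    exact: ef_reindex (red v z) (red v' z') hz.
have h4 (a b c d : V * V) : exists w w' : option (option (option (option V))) -> X,
   [/\ ef0 w w',
    [/\ w None = pair_meets v d, w (Some None) = pair_meets v c,
        w (Some (Some None)) = pair_meets v b & w (Some (Some (Some None))) = pair_meets v a] &
    [/\ w' None = pair_meets v' d, w' (Some None) = pair_meets v' c,
        w' (Some (Some None)) = pair_meets v' b & w' (Some (Some (Some None))) = pair_meets v' a]].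
  have e1 := ef_meet a.1 a.2 h.
  have e2 := ef_meet (Some b.1) (Some b.2) e1.
  have e3 := ef_meet (Some (Some c.1)) (Some (Some c.2)) e2.
  have e4 := ef_meet (Some (Some (Some d.1))) (Some (Some (Some d.2))) e3.
  by do 2!eexists; split; [exact: (ef_ef0 e4) | split | split].
split.
- move=> x y; have [w [w' [[hle _ _] [<- <- _ _] [<- <- _ _]]]] := h4 y y y x.
  by have := hle None (Some None); rewrite /=.
- move=> x y z t; have [w [w' [[_ hC _] [<- <- <- <-] [<- <- <- <-]]]] := h4 t z y x.
  exact: hC.
- move=> q x hq; have [w [w' [[_ _ hU] [<- _ _ _] [<- _ _ _]]]] := h4 x x x x.
  exact: hU.
Qed.

End EF.

(** [Def] is a class of definable relations; the class of all relations will
    do when only the number of equivalence classes matters. *)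
Section FiniteIndex.
Variables (X : structure Lstar) (Q : Type) (U : Q -> X -> Prop) (cs : seq Q).
Variable Def : forall V : Type, ((V -> X) -> Prop) -> Prop.
Hypothesis def_true : forall V, Def (fun _ : V -> X => True).
Hypothesis def_not : forall V (P : (V -> X) -> Prop),
  Def P -> Def (fun v => ~ P v).
Hypothesis def_and : forall V (P R : (V -> X) -> Prop),
  Def P -> Def R -> Def (fun v => P v /\ R v).
Hypothesis def_ex : forall V (P : (option V -> X) -> Prop),
  Def P -> Def (fun v => exists z, P (extend v z)).
Hypothesis def_le : forall V (x y : V), Def (fun v : V -> X => le (v x) (v y)).
Hypothesis def_C : forall V (x y z w : V),
  Def (fun v : V -> X => C (v x) (v y) (v z) (v w)).
Hypothesis def_U : forall V q (x : V), Def (fun v : V -> X => U q (v x)).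

Lemma def_ext V (P R : (V -> X) -> Prop) :
  (forall v, P v <-> R v) -> Def P -> Def R.
Proof.
by move=> h; rewrite (_ : P = R) //; apply: funext => v; apply: propext.
Qed.

Lemma def_code V (I : finType) (P : I -> (V -> X) -> Prop) (c : {ffun I -> bool}) :
  (forall i, Def (P i)) -> Def (fun v => [ffun i => `[< P i v >]] = c).
Proof.
move=> hP.
have hs (s : seq I) : Def (fun v => forall i, i \in s -> `[< P i v >] = c i).
  elim: s => [|i s IH]; first by apply: def_ext (def_true V).
  have hi : Def (fun v => `[< P i v >] = c i).
    case: (c i).
      by apply: def_ext (hP i) => v; split=> [h|/asboolP//]; apply/asboolP.
    by apply: def_ext (def_not (hP i)) => v; split=> [h|/asboolPn//]; apply/asboolPn.
  apply: def_ext (def_and hi IH) => v; split=> [[h1 h2] j|h].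
    by rewrite inE => /orP[/eqP ->|/h2].
  by split=> [|j js]; apply: h; rewrite inE ?eqxx // js orbT.
apply: def_ext (hs (enum I)) => v; split=> [h|<- i _]; last by rewrite ffunE.
by apply/ffunP => i; rewrite ffunE h ?mem_enum.
Qed.

Lemma In_tnth q : List.In q cs -> exists i, tnth (in_tuple cs) i = q.
Proof.
move=> hq; suff [i hi e] : exists2 i, i < size cs & nth q cs i = q.
  by exists (Ordinal hi); rewrite (tnth_nth q) /=.
elim: cs hq => [[]|a s IH [<-|/IH[i hi e]]]; first by exists 0.
by exists i.+1.
Qed.

(** A class of rank [k.+1] is given by a class of rank [k] and by the set of
    those classes of rank [k] that one more element can reach; both range over
    finite types. *)
Lemma ef_finite_index k (V : finType) : exists (K : finType) (h : (V -> X) -> K),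
  (forall v v', h v = h v' -> ef U cs k v v') /\
  forall c, Def (fun v => h v = c).
Proof.
elim: k V => [|k IH] V.
  pose I := (V * V + V * V * (V * V) + 'I_(size cs) * V)%type.
  pose P (i : I) (v : V -> X) : Prop := match i with
    | inl (inl (x, y)) => le (v x) (v y)
    | inl (inr ((x, y), (z, w))) => C (v x) (v y) (v z) (v w)
    | inr (q, x) => U (tnth (in_tuple cs) q) (v x)
    end.
  exists {ffun I -> bool}, (fun v => [ffun i => `[< P i v >]]); split=> [v v' e|c].
    have {}e i : P i v <-> P i v'.
      have /ffunP/(_ i) := e; rewrite !ffunE => ei.
      by split=> h; apply/asboolP; [rewrite -ei | rewrite ei]; apply/asboolP.
    split.
    - by move=> x y; apply: (e (inl (inl (x, y)))).
    - by move=> x y z w; apply: (e (inl (inr ((x, y), (z, w))))).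
    - by move=> q x /In_tnth[i <-]; apply: (e (inr (i, x))).
  by apply: def_code => -[[[x y]|[[x y] [z w]]]|[q x]];
    [exact: def_le | exact: def_C | exact: def_U].
have [K [h [h1 h2]]] := IH V; have [K' [h' [h1' h2']]] := IH (option V).
pose P c v := exists z, h' (extend v z) = c.
exists (K * {ffun K' -> bool})%type, (fun v => (h v, [ffun c => `[< P c v >]])).
split=> [v v' [/h1 e /ffunP e']|[c c']].
  split=> //.
  - move=> z; have := e' (h' (extend v z)); rewrite !ffunE.
    rewrite asboolT; last by exists z.
    by move=> /esym/asboolP[z' ez]; exists z'; apply: h1'.
  - move=> z'; have := e' (h' (extend v' z')); rewrite !ffunE.
    rewrite [RHS]asboolT; last by exists z'.
    by move=> /asboolP[z ez]; exists z; apply: h1'.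
have hc : Def (fun v => [ffun c => `[< P c v >]] = c').
  by apply: def_code => i; apply: (def_ex (h2' i)).
apply: def_ext (def_and (h2 c) hc) => v.
by split=> [[-> ->]|[-> ->]].
Qed.

End FiniteIndex.

(** * Ramsey's theorem *)

Definition increasing_seq (f : nat -> nat) := forall i j, i < j -> f i < f j.

Lemma infinite_fibre (K : finType) (c : nat -> K) :
  exists k, forall N, exists2 t, N <= t & c t = k.
Proof.
apply: contrapT => no.
have /choice[b hb] (k : K) : exists N, forall t, N <= t -> c t <> k.
  apply: contrapT => h; apply: no; exists k => N; apply: contrapT => h'.
  by apply: h; exists N => t Nt e; apply: h'; exists t.
apply: (hb (c (\max_k b k)) (\max_k b k)) => //.
by rewrite (leq_bigmax (c (\max_k b k))).
Qed.

Lemma increasing_fibre (K : finType) (c : nat -> K) :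
  exists k f, increasing_seq f /\ forall i, c (f i) = k.
Proof.
have [k hk] := infinite_fibre c; exists k.
have /choice[g hg] (N : nat) : exists t, N <= t /\ c t = k.
  by have [t] := hk N; exists t.
exists (fun n => iter n (fun t => g t.+1) (g 0)); split; last first.
  by case=> [|i] /=; [have [] := hg 0 | have [] := hg (iter i (fun t => g t.+1) (g 0)).+1].
move=> i j; elim: j => [//|j IH]; rewrite ltnS leq_eqVlt => /orP[/eqP ->|/IH h] /=.
  by have [] := hg (iter j (fun t => g t.+1) (g 0)).+1.
by apply: ltn_trans h _; have [] := hg (iter j (fun t => g t.+1) (g 0)).+1.
Qed.

(** The induction on [n] thins out the sequence repeatedly: [G t] enumerates what
    is left after [t] stages, and the colour of a tuple of heads [G t 0] then
    depends on its first member only. *)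
Lemma ramsey (K : finType) n (col : seq nat -> K) : exists f k, increasing_seq f /\
  forall s, sorted ltn s -> size s = n -> col (map f s) = k.
Proof.
elim: n col => [|n IH] col.
  by exists id, (col [::]); split=> // s _ /size0nil ->.
have /choice[step hstep] (g : nat -> nat) : exists fk : (nat -> nat) * K,
    increasing_seq fk.1 /\ forall s, sorted ltn s -> size s = n ->
      col (g 0 :: map (g \o succn \o fk.1) s) = fk.2.
  have [f [k [hf hk]]] := IH (fun s => col (g 0 :: map (g \o succn) s)).
  by exists (f, k); split=> // s hs sn; rewrite -(hk s hs sn) -map_comp.
pose next g := g \o succn \o (step g).1.
pose G t := iter t next id.
have Gincr t : increasing_seq (G t).
  elim: t => [//|t IHt] i j ij; apply: IHt; rewrite /= ltnS.
  by have [h _] := hstep (G t); apply: h.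
have tail t u : exists2 e, increasing_seq e & G (t + u) =1 G t \o e.
  elim: u => [|u [e he hu]]; first by rewrite addn0; exists id.
  exists (e \o succn \o (step (G (t + u))).1) => [i j ij|i].
    by apply: he; rewrite ltnS; have [h _] := hstep (G (t + u)); apply: h.
  by rewrite addnS /= [in LHS]/next /= hu.
pose x t := G t 0.
have x_in t u : t < u -> exists e, x u = G t.+1 e.
  move=> tu; have [e _ he] := tail t.+1 (u - t.+1).
  by exists (e 0); rewrite -[RHS]/((G t.+1 \o e) 0) -he subnKC.
have xS t u : t < u -> x t < x u.
  by move=> /x_in[e ->]; rewrite /= /next /=; apply: Gincr.
have [k [f [hf hk]]] := increasing_fibre (fun t => (step (G t)).2).
exists (x \o f), k; split=> [i j ij|s]; first exact/xS/hf.
case: s => [//|a s] /= srt [sn].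
have /choice[e he] (i : nat) : exists e, a < i -> x (f i) = G (f a).+1 e.
  by case: (ltnP a i) => [/hf/x_in[e he]|]; [exists e | exists 0].
have alls : all (ltn a) s by apply: order_path_min srt => //; exact: ltn_trans.
have emap : map (x \o f) s = map (G (f a).+1) (map e s).
  rewrite -map_comp; apply/eq_in_map => i /(allP alls) ai /=; exact: he.
rewrite emap -(hk a); have [_ h] := hstep (G (f a)); apply: h; last by rewrite size_map.
have lte i j : a < i -> i < j -> e i < e j.
  move=> ai ij; rewrite ltnNge; apply/negP => ji.
  have := xS _ _ (hf _ _ ij); rewrite (he i ai) (he j (ltn_trans ai ij)).
  move: ji; rewrite leq_eqVlt => /orP[/eqP ->|/(Gincr (f a).+1)]; first by rewrite ltnn.
  by move=> h1 /(ltn_trans h1); rewrite ltnn.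
move: alls srt; elim: (s) => [//|b [//|b' s'] IHs] /= /andP[ab alls] /andP[_ srt].
have /andP[bb' srt'] := srt; rewrite lte //=.
apply: IHs => //=; rewrite srt' andbT; by case/andP: alls.
Qed.

(** * Regions and gluing *)

(** A region stands for a subset of the tree, see [inside]: a closed cone, or the
    cones above [c] that lie strictly between those of [a] and [b]. *)
Inductive region (T : Type) := Above of T | Between of T & T & T.

Section Regions.
Variables (X : structure Lstar) (hX : circ_tree X).
Implicit Types (x y z a b c u m w : X).

Definition inside (D : region X) (z : X) : Prop :=
  match D with Above c => le c z | Between c a b => C c a z b end.

(** The parameters of the region, and one of its elements, belong to [s].  For
    [Above c] the element is [c] itself. *)
Definition anchored (S : Type) (s : S -> X) (D : region X) : Prop :=
  match D with
  | Above c => exists i, s i = c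
  | Between c a b => exists i j k l,
      [/\ s i = c, s j = a, s k = b & C c a (s l) b]
  end.

Lemma inside_up D x y : inside D x -> le x y -> inside D y.
Proof.
case: D => [c|c a b] /= h xy; first exact: (le_trans hX h xy).
have [ca cx cb] := C_above hX h.
apply: (C_inv hX) h; [exact: (cone_refl hX)| | exact: (cone_refl hX)].
exact: (cone_above hX cx (le_refl hX x) xy).
Qed.

Lemma outside_le D x u m : ~ inside D x -> inside D u -> inside D m ->
  le x u -> le x m.
Proof.
case: D => [c|c a b] /= nx hu hm xu.
  have [h|//] := le_linear hX xu hu; exact: (le_trans hX h hm).
have [_ cu _] := C_above hX hu; have [_ cm _] := C_above hX hm.
have [xc|cx] := le_linear hX xu cu.1; first exact: (le_trans hX xc cm.1).
have [<-|ne] := pselect (c = x); first exact: cm.1.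
case: nx; apply: (@C_inv _ hX c a a u x b b) hu; [| | ].
- by have [? _ _] := C_above hX hm; exact: (cone_refl hX).
- apply: (@cone_above _ hX c x); by [split | | exact: (le_refl hX)].
- by have [_ _ ?] := C_above hX hm; exact: (cone_refl hX).
Qed.

(** A point outside and below an element of the region is strictly below [c], so
    that the region lies in a single cone above it, or is the centre [c] of an
    arc. *)
Lemma outside_cone D x u m : ~ inside D x -> inside D u -> inside D m ->
  lt x u -> same_cone x u m \/ exists a b, D = Between x a b.
Proof.
case: D => [c|c a b] /= nx hu hm xu.
  left; have [h|//] := le_linear hX xu.1 hu.
  apply: (@cone_above _ hX x c) => //; split=> // e; apply: nx; rewrite e; exact: (le_refl hX).
have [ca cu cb] := C_above hX hu; have [_ cm _] := C_above hX hm.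
have [->|ne] := pselect (x = c); first by right; exists a, b.
left; have [xc|cx] := le_linear hX xu.1 cu.1.
  by apply: (@cone_above _ hX x c); [split | exact: cu.1 | exact: cm.1].
case: nx; apply: (@C_inv _ hX c a a u x b b) hu; [exact: (cone_refl hX)| | exact: (cone_refl hX)].
apply: (@cone_above _ hX c x); [|exact: xu.1|exact: (le_refl hX)].
by split=> // e; apply: ne.
Qed.

Lemma between_cone c a b u w : inside (Between c a b) u -> same_cone c u w ->
  inside (Between c a b) w.
Proof.
move=> /= h uw; have [ca cu cb] := C_above hX h.
by apply: (C_inv hX) h => //; exact: (cone_refl hX).
Qed.

(** Starting from its end [a], one runs through the whole arc before reaching any
    point [w] off the arc; so [w] is placed like [a] with respect to [u1], [u2]. *)
Lemma two_inside c a b u1 u2 w :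
  inside (Between c a b) u1 -> inside (Between c a b) u2 -> lt c w ->
  ~ inside (Between c a b) w -> C c u1 u2 w <-> C c u1 u2 a.
Proof.
move=> h1 h2 cw nw.
have [ca c1 cb] := C_above hX h1; have [_ c2 _] := C_above hX h2.
have key v1 v2 : inside (Between c a b) v1 -> inside (Between c a b) v2 ->
    C c v1 v2 a -> C c v1 v2 w.
  move=> k1 k2 /(C_rot hX)/(C_rot hX) a12.
  have [_ d1 _] := C_above hX k1; have [_ d2 _] := C_above hX k2.
  have [aw|naw] := pselect (same_cone c a w).
    apply: (C_inv hX (cone_refl hX d1) (cone_refl hX d2) aw).
    by apply: (C_rot hX).
  have a2w : C c a v2 w.
    have [bw|nbw] := pselect (same_cone c b w).
      exact: (C_inv hX (cone_refl hX ca) (cone_refl hX d2) bw).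
    have nab : ~ same_cone c a b.
      by move=> h; apply: (C_neq hX (C_rot hX (C_rot hX k1))); apply: (cone_sym hX).
    have [abw|h] := C_total hX ca cb cw nab nbw naw.
      exact: (ct_trans hX k2 abw).
    by case: nw; exact: C_rot h.
  exact: (C_trans4 hX a12 a2w).
split; last exact: key.
move=> h12; have n12 := C_neq hX h12.
have n1a : ~ same_cone c u1 a.
  by move=> h; apply: (C_neq hX h1); apply: (cone_sym hX).
have n2a : ~ same_cone c u2 a.
  by move=> h; apply: (C_neq hX h2); apply: (cone_sym hX).
have [//|h] := C_total hX c1 c2 ca n12 n2a n1a.
by case: (C_asym hX h12); apply: key.
Qed.

(** If [u] and [m] lie in different cones above [x], then the region is an arc
    around [x]; by [two_inside], [w1] and [w2] see [u] and [m] in the same order,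
    so that [u] and [m] lie on the same side when [w1], [w2] cut the circle. *)
Lemma one_inside D x u m w1 w2 : ~ inside D x -> inside D u -> inside D m ->
  ~ inside D w1 -> ~ inside D w2 -> C x u w1 w2 -> C x m w1 w2.
Proof.
move=> nx hu hm n1 n2 h; have [xu x1 x2] := C_above hX h.
have [um|[a [b e]]] := outside_cone nx hu hm xu.
  exact: (C_inv1 hX um h).
subst D; have [um|num] := pselect (same_cone x u m); first exact: (C_inv1 hX um h).
have [_ xm _] := C_above hX hm.
have nm1 : ~ same_cone x m w1 by move=> /(between_cone hm).
have nm2 : ~ same_cone x m w2 by move=> /(between_cone hm).
have n12 : ~ same_cone x w1 w2 by have := C_neq hX (C_rot hX h).
have [//|h'] := C_total hX xm x1 x2 nm1 n12 nm2.
have nu1 := C_neq hX h.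
have [um1|mu1] := C_total hX xu xm x1 num nm1 nu1.
  have um2 : C x u m w2 by apply/(two_inside hu hm x2 n2)/(two_inside hu hm x1 n1).
  by case: (C_asym hX (C_trans4 hX um1 h)).
have mu2 : C x m u w2 by apply/(two_inside hm hu x2 n2)/(two_inside hm hu x1 n1).
have k := C_trans4 hX mu2 (C_rot hX h').
by case: (C_asym hX h); do 2!apply: (C_rot hX).
Qed.

(** Half of a partial isomorphism; the other half is the same statement about the
    converse of [R]. *)
Definition preserves (R : X -> X -> Prop) : Prop :=
  [/\ forall a a' b b', R a a' -> R b b' -> le a b -> le a' b',
      forall a a' b, R a a' -> R b a' -> a = b &
      forall x x' a a' b b' c c', R x x' -> R a a' -> R b b' -> R c c' ->
        C x a b c -> C x' a' b' c'].

Lemma preserves_fix R x x' : preserves R -> R x x -> R x x' -> x = x'.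
Proof.
move=> [h _ _] rx rx'; apply: (le_anti hX); [apply: (h x x x) | apply: (h x _ x)] => //;
  exact: (le_refl hX).
Qed.

(** The round-zero case of gluing.  Replace every inner element of an atomic
    formula by the inner parameter [m] when this is harmless ([outside_le],
    [one_inside]).  In the other mixed case, two inner points seen from the
    centre of an arc, replace the outer one by the end of the arc
    ([two_inside]). *)
Lemma preserves_glue S (s : S -> X) D (Rin Rout : X -> X -> Prop) :
  anchored s D -> (forall i, Rin (s i) (s i)) -> (forall i, Rout (s i) (s i)) ->
  preserves Rin -> preserves Rout ->
  preserves (fun a a' => [/\ inside D a, inside D a' & Rin a a'] \/
                         [/\ ~ inside D a, ~ inside D a' & Rout a a']).
Proof.
move=> hD sin sout pin pout.
have [m hm [inm outm]] : exists2 m, inside D m & Rin m m /\ Rout m m.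
  case: (D) hD => [c [i <-]|c a b [i [j [k [l [_ _ _ h]]]]]].
    by exists (s i) => //; exact: (le_refl hX).
  by exists (s l).
have [in_le in_inj in_C] := pin; have [out_le out_inj out_C] := pout.
split.
- move=> a a' b b' [[ia ia' ra]|[oa oa' ra]] [[ib ib' rb]|[ob ob' rb]] ab.
  + exact: in_le ab.
  + by case: ob; apply: inside_up ab.
  + apply: (outside_le oa' hm ib'); apply: (out_le _ _ _ _ ra outm).
    exact: (outside_le oa ib hm ab).
  + exact: out_le ab.
- move=> a a' b [[ia ia' ra]|[oa oa' ra]] [[ib ib' rb]|[ob ob' rb]] //.
  + exact: in_inj rb.
  + exact: out_inj rb.
(* An outer point that sees two inner points in different cones is the centre
   of an arc, hence a parameter, hence answered by itself. *)
have centre x x' a b c : ~ inside D x -> Rout x x' -> inside D a -> inside D b ->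
    C x a b c -> x = x' /\ exists p q, [/\ D = Between x p q, Rin x x & Rin p p].
  move=> ox rx ia ib h; have [xa xb _] := C_above hX h.
  suff [p [q e]] : exists p q, D = Between x p q.
    move: hD; rewrite e => -[i [j [_ [_ [ei ej _ _]]]]].
    split; last by exists p, q; rewrite -ei -ej.
    by apply: (preserves_fix pout) rx; rewrite -ei.
  have [ha|//] := outside_cone ox ia hm xa; have [hb|//] := outside_cone ox ib hm xb.
  by case: (C_neq hX h); exact: (cone_trans hX ha (cone_sym hX hb)).
(* L1, L2, L3: one, two or three of the points seen from x are inner; rotation
   reduces every other distribution to one of these. *)
have L1 x x' a a' b b' c c' : ~ inside D x -> ~ inside D x' -> Rout x x' ->
    inside D a -> inside D a' -> ~ inside D b -> ~ inside D b' -> Rout b b' ->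
    ~ inside D c -> ~ inside D c' -> Rout c c' -> C x a b c -> C x' a' b' c'.
  move=> ox ox' rx ia ia' ob ob' rb oc oc' rc h.
  apply: (one_inside ox' hm ia' ob' oc').
  apply: (out_C _ _ _ _ _ _ _ _ rx outm rb rc).
  exact: (one_inside ox ia hm ob oc h).
have L2 x x' a a' b b' c c' : ~ inside D x -> Rout x x' ->
    inside D a -> inside D a' -> Rin a a' -> inside D b -> inside D b' -> Rin b b' ->
    ~ inside D c -> ~ inside D c' -> Rout c c' -> C x a b c -> C x' a' b' c'.
  move=> ox rx ia ia' ra ib ib' rb oc oc' rc h; have [_ _ xc] := C_above hX h.
  have [ex [p [q [e rx1 rp]]]] := centre _ _ _ _ _ ox rx ia ib h; subst x' D.
  have xc' : lt x c'.
    split; first exact: out_le xc.1.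
    by move=> ec; apply: xc.2; apply: (out_inj _ c') => //; rewrite -ec.
  apply/(two_inside ia' ib' xc' oc'); apply: (in_C _ _ _ _ _ _ _ _ rx1 ra rb rp).
  exact/(two_inside ia ib xc oc).
have L3 x x' a a' b b' c c' : ~ inside D x -> Rout x x' ->
    inside D a -> Rin a a' -> inside D b -> Rin b b' -> Rin c c' ->
    C x a b c -> C x' a' b' c'.
  move=> ox rx ia ra ib rb rc h.
  have [ex [p [q [e rx1 rp]]]] := centre _ _ _ _ _ ox rx ia ib h; subst x'.
  exact: (in_C _ _ _ _ _ _ _ _ rx1 ra rb rc h).
move=> x x' a a' b b' c c' rx ra rb rc h; have [xa xb xc] := C_above hX h.
case: rx => [[ix ix' rx]|[ox ox' rx]].
  have aux y y' : inside D y ->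
      [/\ inside D y, inside D y' & Rin y y'] \/
      [/\ ~ inside D y, ~ inside D y' & Rout y y'] -> Rin y y'.
    by move=> iy [[]|[]].
  apply: (in_C _ _ _ _ _ _ _ _ rx) h; [apply: aux ra | apply: aux rb | apply: aux rc].
  - exact: inside_up ix xa.1.
  - exact: inside_up ix xb.1.
  - exact: inside_up ix xc.1.
case: ra rb rc => [[ia ia' ra]|[oa oa' ra]] [[ib ib' rb]|[ob ob' rb]]
  [[ic ic' rc]|[oc oc' rc]].
- exact: L3 h.
- exact: L2 h.
- by apply: (C_rot hX); apply: (L2 x x' c c' a a' b b') => //; apply: (C_rot hX (C_rot hX h)).
- exact: L1 h.
- by do 2!apply: (C_rot hX); apply: (L2 x x' b b' c c' a a') => //; exact: (C_rot hX h).
- by do 2!apply: (C_rot hX); apply: (L1 x x' b b' c c' a a') => //; exact: (C_rot hX h).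
- by apply: (C_rot hX); apply: (L1 x x' c c' a a' b b') => //; apply: (C_rot hX (C_rot hX h)).
- exact: (out_C _ _ _ _ _ _ _ _ rx ra rb rc h).
Qed.

End Regions.

Section Gluing.
Variables (X : structure Lstar) (hX : circ_tree X).
Variables (Q : Type) (U : Q -> X -> Prop) (cs : seq Q).

Definition restr (V : Type) (P : V -> Prop) (v : V -> X) (x : {x | P x}) : X :=
  v (sval x).

Local Notation ef := (ef U cs).

(* A subset of the variables is a sigma type, so a move of the game has to be
   transported between [option] and such types. *)
Lemma ef_restr_extend S (s : S -> X) k V (P : V -> Prop) (P' : option V -> Prop)
    (v v' : V -> X) z z' :
  (forall x, P' (Some x) -> P x) ->
  ef k (extend (join s (restr (P := P) v)) z) (extend (join s (restr (P := P) v')) z') ->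
  ef k (join s (restr (P := P') (extend v z))) (join s (restr (P := P') (extend v' z'))).
Proof.
move=> hP; pose f (y : S + {o | P' o}) : option (S + {x | P x}) := match y with
  | inl i => Some (inl i)
  | inr (exist (Some x) h) => Some (inr (exist _ x (hP x h)))
  | inr (exist None _) => None
  end.
by apply: (ef_reindex (f := f)) => -[i|[[x|] h]].
Qed.

Lemma ef_restr_skip S (s : S -> X) k V (P : V -> Prop) (P' : option V -> Prop)
    (v v' : V -> X) z z' :
  (forall x, P' (Some x) -> P x) -> ~ P' None ->
  ef k (join s (restr (P := P) v)) (join s (restr (P := P) v')) ->
  ef k (join s (restr (P := P') (extend v z))) (join s (restr (P := P') (extend v' z'))).
Proof.
move=> hP hN; pose f (y : S + {o | P' o}) : S + {x | P x} := match y with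
  | inl i => inl i
  | inr (exist (Some x) h) => inr (exist _ x (hP x h))
  | inr (exist None h) => False_rect _ (hN h)
  end.
by apply: (ef_reindex (f := f)) => -[i|[[x|] h]] //=; case: (hN h).
Qed.

Lemma ef_inside S (s : S -> X) D k W (w w' : W -> X) (g : S -> W) y :
  anchored s D -> (forall i, w (g i) = s i) -> (forall i, w' (g i) = s i) ->
  ef k w w' -> inside D (w y) <-> inside D (w' y).
Proof.
move=> hD e e' h; have e2 i : s i = w (g i) /\ s i = w' (g i) by rewrite e e'.
case: D hD => [c [i <-]|c a b [i [j [m [_ [<- <- <- _]]]]]] /=.
  rewrite {1}(e2 i).1 (e2 i).2; have [h1 _ _] := ef_ef0 h; exact: h1.
rewrite {1}(e2 i).1 {1}(e2 j).1 {1}(e2 m).1 (e2 i).2 (e2 j).2 (e2 m).2.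
by have [_ h1 _] := ef_ef0 h; exact: h1.
Qed.

Lemma ef0_preserves V (v v' : V -> X) : ef0 U cs v v' ->
  preserves (fun a a' => exists x, a = v x /\ a' = v' x).
Proof.
move=> h; split.
- move=> _ _ _ _ [x [-> ->]] [y [-> ->]]; exact: (@ef_le _ _ U cs 0 _ v v').
- move=> _ _ _ [x [-> ->]] [y [-> e]].
  exact: (ef_eq hX (ef_sym (h : ef 0 v v'))).
- move=> _ _ _ _ _ _ _ _ [x [-> ->]] [a [-> ->]] [b [-> ->]] [c [-> ->]].
  exact: (@ef_C _ _ U cs 0 _ v v').
Qed.

(** Elements inside and outside an anchored region do not interact: duplicator
    answers a move inside the region in one game and a move outside in another. *)
Lemma glue S (s : S -> X) D k V (P : V -> Prop) (v v' : V -> X) :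
  anchored s D ->
  (forall x, P x -> inside D (v x) /\ inside D (v' x)) ->
  (forall x, ~ P x -> ~ inside D (v x) /\ ~ inside D (v' x)) ->
  ef k (join s (restr (P := P) v)) (join s (restr (P := P) v')) ->
  ef k (join s (restr (P := fun x => ~ P x) v))
       (join s (restr (P := fun x => ~ P x) v')) ->
  ef k v v'.
Proof.
move=> hD; elim: k V P v v' => [|k IH] V P v v' hP hN h1 h2; last first.
  have [h1a h1b h1c] := h1; have [h2a h2b h2c] := h2.
  have step z z' :
      [/\ inside D z, inside D z' & ef k (extend (join s (restr (P := P) v)) z)
        (extend (join s (restr (P := P) v')) z')] \/
      [/\ ~ inside D z, ~ inside D z' & ef k (extend (join s (restr (P := fun x => ~ P x) v)) z)
        (extend (join s (restr (P := fun x => ~ P x) v')) z')] ->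
      ef k (extend v z) (extend v' z').
    move=> [[iz iz' hz]|[oz oz' hz]].
      apply: (IH _ (fun o => if o is Some x then P x else True)).
      - by case=> [x /hP|].
      - by case=> [x /hN|].
      - by apply: ef_restr_extend hz.
      - by apply: ef_restr_skip h2a => //=; apply.
    apply: (IH _ (fun o => if o is Some x then P x else False)).
    - by case=> [x /hP|].
    - by case=> [x /hN|].
    - by apply: ef_restr_skip h1a.
    - by apply: ef_restr_extend hz.
  split; first exact: IH h1a h2a.
  - move=> z; have [iz|oz] := pselect (inside D z).
      have [z' hz] := h1b z; exists z'; apply: step; left; split=> //.
      exact/(ef_inside (g := Some \o inl) None hD _ _ hz).
    have [z' hz] := h2b z; exists z'; apply: step; right; split=> //.
    by move=> iz'; apply: oz; apply/(ef_inside (g := Some \o inl) None hD _ _ hz).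
  - move=> z'; have [iz|oz] := pselect (inside D z').
      have [z hz] := h1c z'; exists z; apply: step; left; split=> //.
      exact/(ef_inside (g := Some \o inl) None hD _ _ hz).
    have [z hz] := h2c z'; exists z; apply: step; right; split=> //.
    by move=> iz'; apply: oz; apply/(ef_inside (g := Some \o inl) None hD _ _ hz).
have main (u u' : V -> X) :
    (forall x, P x -> inside D (u x) /\ inside D (u' x)) ->
    (forall x, ~ P x -> ~ inside D (u x) /\ ~ inside D (u' x)) ->
    ef 0 (join s (restr (P := P) u)) (join s (restr (P := P) u')) ->
    ef 0 (join s (restr (P := fun x => ~ P x) u))
       (join s (restr (P := fun x => ~ P x) u')) ->
    (forall x y, le (u x) (u y) -> le (u' x) (u' y)) /\
    (forall x y z w, C (u x) (u y) (u z) (u w) -> C (u' x) (u' y) (u' z) (u' w)).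
  move=> hp hn g1 g2.
  have [] := preserves_glue hX hD _ _ (ef0_preserves g1) (ef0_preserves g2).
  - by move=> i; exists (inl i).
  - by move=> i; exists (inl i).
  have pair x : [/\ inside D (u x), inside D (u' x) & exists y,
         u x = join s (restr (P := P) u) y /\ u' x = join s (restr (P := P) u') y] \/
      [/\ ~ inside D (u x), ~ inside D (u' x) & exists y,
         u x = join s (restr (P := fun x => ~ P x) u) y /\
         u' x = join s (restr (P := fun x => ~ P x) u') y].
    have [px|px] := pselect (P x); [left|right].
      by have [? ?] := hp x px; split=> //; exists (inr (exist _ x px)).
    by have [? ?] := hn x px; split=> //; exists (inr (exist _ x px)).
  by move=> h _ h'; split=> *; [apply: h | apply: h'].
have [m1 m2] := main v v' hP hN h1 h2.
have [||m1' m2'] := main v' v _ _ (ef_sym h1) (ef_sym h2).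
- by move=> x /hP[].
- by move=> x /hN[].
split; [by split; [apply: m1|apply: m1'] | by split; [apply: m2|apply: m2'] |].
move=> q x hq; have [px|px] := pselect (P x).
  by have [_ _ /(_ q (inr (exist _ x px)) hq)] := h1.
by have [_ _ /(_ q (inr (exist _ x px)) hq)] := h2.
Qed.

Lemma glue_join S (s : S -> X) D k V (v v' : V -> X) :
  anchored s D -> (forall x, inside D (v x) <-> inside D (v' x)) ->
  let P x := inside D (v x) in
  ef k (join s (restr (P := P) v)) (join s (restr (P := P) v')) ->
  ef k (join s (restr (P := fun x => ~ P x) v))
       (join s (restr (P := fun x => ~ P x) v')) ->
  ef k (join s v) (join s v').
Proof.
move=> hD hv P h1 h2.
apply: (glue (P := fun y => inside D (join s v y)) hD).
- by case=> [i|x] //= h; split=> //; apply/hv.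
- by case=> [i|x] //= h; split=> // /hv.
- pose f (y : S + {x | inside D (join s v x)}) : S + {x | P x} := match y with
    | inl i => inl i
    | inr (exist (inl i) _) => inl i
    | inr (exist (inr x) h) => inr (exist _ x h)
    end.
  by apply: (ef_reindex (f := f)) h1 => -[i|[[i|x] h]].
- pose f (y : S + {x | ~ inside D (join s v x)}) : S + {x | ~ P x} := match y with
    | inl i => inl i
    | inr (exist (inl i) _) => inl i
    | inr (exist (inr x) h) => inr (exist _ x h)
    end.
  by apply: (ef_reindex (f := f)) h2 => -[i|[[i|x] h]].
Qed.

(** Regions cut the variables into classes; iterated gluing reduces equivalence
    to the classes that no region of the list separates. *)
Lemma glue_list S (s : S -> X) (Ds : seq (region X)) k V (v v' : V -> X) :
  (forall D, List.In D Ds -> anchored s D) ->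
  (forall D, List.In D Ds -> forall x, inside D (v x) <-> inside D (v' x)) ->
  (forall W (f : W -> V), (forall D, List.In D Ds -> forall x y,
      inside D (v (f x)) <-> inside D (v (f y))) ->
    ef k (join s (v \o f)) (join s (v' \o f))) ->
  ef k (join s v) (join s v').
Proof.
elim: Ds V v v' => [|D Ds IH] V v v' hs hv h; first exact: (h V id).
apply: (@glue_join _ s D); [by apply: hs; left | by apply: hv; left | |].
- apply: IH => [E hE|E hE x|W f hf]; [by apply: hs; right | by apply: hv; right|].
  apply: (h W (sval \o f)) => E [<-|hE] x y; last exact: hf.
  by split=> _; [exact: (svalP (f y)) | exact: (svalP (f x))].
- apply: IH => [E hE|E hE x|W f hf]; [by apply: hs; right | by apply: hv; right|].
  apply: (h W (sval \o f)) => E [<-|hE] x y; last exact: hf.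
  by split=> i; [case: (svalP (f x) i) | case: (svalP (f y) i)].
Qed.

Lemma In_mem (Y : eqType) (y : Y) (l : seq Y) : y \in l -> List.In y l.
Proof.
elim: l => [//|z l IH]; rewrite inE => /orP[/eqP ->|/IH]; [by left | by right].
Qed.

(** Leave out the entries of [x] that are parameters.  Then no class of variables
    that the regions leave together mixes an entry of [x] and one of [b]: on the
    former the hypothesis applies, and the latter do not move. *)
Lemma ef_replace (Y : finType) S W (s : S -> X) (x x' : Y -> X) (b : W -> X) k :
  ef k (join s x) (join s x') ->
  (forall l, (exists i, x l = s i /\ x' l = s i) \/
    exists Ds, (forall D, List.In D Ds -> anchored s D) /\
      forall w, exists2 D, List.In D Ds & ~ (inside D (x l) <-> inside D (b w))) ->
  ef k (join x b) (join x' b).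
Proof.
move=> hx hl; pose N l := ~ exists i, x l = s i /\ x' l = s i.
have /choice[Ds hDs] l : exists Ds, (forall D, List.In D Ds -> anchored s D) /\
    (N l -> forall w, exists2 D, List.In D Ds & ~ (inside D (x l) <-> inside D (b w))).
  by case: (hl l) => [h|[Ds [h1 h2]]]; [exists [::] | exists Ds].
pose All := List.flat_map Ds (enum Y).
have anch D : List.In D All -> anchored s D.
  by move=> /List.in_flat_map[l [_]]; apply: (hDs l).1.
pose y u := join (fun l : {l | N l} => u (sval l)) b.
have hy : ef k (join s (y x)) (join s (y x')).
  apply: (glue_list (Ds := All)) => //.
    move=> D hD [[l nl]|w] //=.
    exact: (ef_inside (g := inl) (inr l) (anch D hD) _ _ hx).
  move=> V f hf; have [[t0 [w0 e0]]|none] := pselect (exists t w, f t = inr w).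
    suff -> : y x' \o f = y x \o f by exact: ef_refl.
    apply: funext => t /=; case e : (f t) => [[l nl]|w] //=.
    have [D inD] := (hDs l).2 nl w0; case.
    have inA : List.In D All.
      by apply/List.in_flat_map; exists l; split=> //; apply: In_mem; rewrite mem_enum.
    by have := hf D inA t t0; rewrite e e0.
  have /choice[g hg] t : exists l, f t = inl l.
    by case e : (f t) => [l|w]; [exists l | case: none; exists t, w].
  pose h (z : S + V) : S + Y := match z with inl i => inl i | inr t => inr (sval (g t)) end.
  by apply: (ef_reindex (f := h)) hx => -[i|t] //=; rewrite hg.
have /choice[c hc] l : exists z, x l = join s (y x) z /\ x' l = join s (y x') z.
  have [[i [-> ->]]|nl] := pselect (exists i, x l = s i /\ x' l = s i); first by exists (inl i).
  by exists (inr (inl (exist _ l nl))).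
pose h (z : Y + W) : S + ({l | N l} + W) :=
  match z with inl l => c l | inr w => inr (inr w) end.
by apply: (ef_reindex (f := h)) hy => -[l|w] //=; have [] := hc l.
Qed.

End Gluing.

(** * Homogeneous sequences *)

(** The four shapes of a nonconstant homogeneous sequence; [Fan] and [FanR] are
    the two directions around the common meet. *)
Inductive kind := Up | Down | Fan | FanR.

Section Kinds.
Variables (X : structure Lstar) (hX : circ_tree X).
Implicit Types (x y a b c e : X).

(** [e0], [e1] stand for two terms before, and [e2], [e3] for two terms after,
    the middle of a block.  Two terms are taken on each side because the meets
    of consecutive terms, rather than the terms, bound the gap. *)
Definition regions (t : kind) (e0 e1 e2 e3 : X) : seq (region X) :=
  match t with
  | Up | Down => [:: Above (meet e0 e1); Above (meet e2 e3)]
  | Fan => [:: Between (meet e0 e1) e0 e3]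
  | FanR => [:: Between (meet e0 e1) e3 e0]
  end.

Definition gap (t : kind) (e0 e1 e2 e3 x : X) : Prop :=
  match t with
  | Up => le (meet e0 e1) x /\ ~ le (meet e2 e3) x
  | Down => le (meet e2 e3) x /\ ~ le (meet e0 e1) x
  | Fan => C (meet e0 e1) e0 x e3
  | FanR => C (meet e0 e1) e3 x e0
  end.

(** Provides the inner element that [anchored] asks of an arc. *)
Definition gap_marked (t : kind) (e0 e1 e3 : X) : Prop :=
  match t with
  | Up | Down => True
  | Fan => C (meet e0 e1) e0 e1 e3
  | FanR => C (meet e0 e1) e3 e1 e0
  end.

Lemma gap_separates t e0 e1 e2 e3 x y :
  gap t e0 e1 e2 e3 x -> ~ gap t e0 e1 e2 e3 y ->
  exists2 D, List.In D (regions t e0 e1 e2 e3) & ~ (inside D x <-> inside D y).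
Proof.
move=> hx hy; apply: contrapT => h; apply: hy.
have {}h D : List.In D (regions t e0 e1 e2 e3) -> inside D x <-> inside D y.
  by move=> hD; apply: contrapT => h'; apply: h; exists D.
case: t hx h => /= hx h.
- by move: hx (h _ (or_introl erefl)) (h _ (or_intror (or_introl erefl))) => /=; tauto.
- by move: hx (h _ (or_introl erefl)) (h _ (or_intror (or_introl erefl))) => /=; tauto.
- exact: (h _ (or_introl erefl)).1.
- exact: (h _ (or_introl erefl)).1.
Qed.

Lemma regions_anchored t V (v : V -> X) p0 p1 p2 p3 D :
  gap_marked t (v p0) (v p1) (v p3) ->
  List.In D (regions t (v p0) (v p1) (v p2) (v p3)) -> anchored (pair_meets v) D.
Proof.
have mp p : pair_meets v (p, p) = v p by rewrite /pair_meets (meetxx hX).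
case: t => /= [_ [<-|[<-|//]]|_ [<-|[<-|//]]|h [<-|//]|h [<-|//]].
- by exists (p0, p1).
- by exists (p2, p3).
- by exists (p0, p1).
- by exists (p2, p3).
- by exists (p0, p1), (p0, p0), (p3, p3), (p1, p1); rewrite !mp.
- by exists (p0, p1), (p3, p3), (p0, p0), (p1, p1); rewrite !mp.
Qed.

(** Both [meet a b] and [meet b c] lie below [b], hence are comparable: of the
    three meets of three points in a tree, the least is attained twice. *)
Lemma meet3 a b c : ~ le (meet b c) (meet a b) ->
  meet a b = meet a c /\ lt (meet a b) (meet b c).
Proof.
move=> h; have ab : le (meet a b) (meet b c).
  by have [|/h] := le_linear hX (meetr hX a b) (meetl hX b c).
split; last by split=> // e; apply: h; rewrite e; exact: (le_refl hX).
apply: (le_anti hX); apply: (le_meet hX); try exact: (meetl hX).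
  exact: (le_trans hX ab (meetr hX b c)).
have [k|k] := le_linear hX (meetr hX a c) (meetr hX b c).
  exact: (le_trans hX k (meetl hX b c)).
case: h; apply: (le_meet hX); last exact: (meetl hX).
exact: (le_trans hX k (meetl hX a c)).
Qed.

End Kinds.

Section Classification.
Variables (X : structure Lstar) (hX : circ_tree X).
Variables (I : Type) (lti : I -> I -> Prop).
Hypothesis lin : strict_linear_order lti.
Hypothesis nomax : forall i, exists j, lti i j.
Hypothesis inh : inhabited I.
Variable z : I -> X.

(** Triples suffice: by [meet3] they fix the position of the meets. *)
Definition homogeneous : Prop := forall t t' : 'I_3 -> I,
  increasing lti t -> increasing lti t' ->
  (forall p q, le (pair_meets (z \o t) p) (pair_meets (z \o t) q) ->
     le (pair_meets (z \o t') p) (pair_meets (z \o t') q)) /\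
  (forall p q r s, C (pair_meets (z \o t) p) (pair_meets (z \o t) q) (pair_meets (z \o t) r)
     (pair_meets (z \o t) s) -> C (pair_meets (z \o t') p) (pair_meets (z \o t') q)
     (pair_meets (z \o t') r) (pair_meets (z \o t') s)).

Hypothesis hz : homogeneous.

Local Notation m i j := (meet (z i) (z j)).

Let tr := slo_trans lin.

Let triple i j k : 'I_3 -> I := tnth [tuple i; j; k].

Let incr3 i j k : lti i j -> lti j k -> increasing lti (triple i j k).
Proof.
move=> ij jk [[|[|[|//]]] ha] [[|[|[|//]]] hb] //= _; rewrite /triple !(tnth_nth i) //=.
exact: tr ij jk.
Qed.

Let o0 : 'I_3 := ord0.
Let o1 : 'I_3 := Ordinal (isT : 1 < 3).
Let o2 : 'I_3 := Ordinal (isT : 2 < 3).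

Lemma common_above i j : exists k, lti i k /\ lti j k.
Proof.
have [k ik] := nomax i; have [l jl] := nomax j.
have [kl|e|lk] := slo_total lin k l.
- by exists l; split=> //; exact: tr ik kl.
- by exists k; split=> //; rewrite e.
- by exists k; split=> //; exact: tr jl lk.
Qed.

(** Compare [m i j] with [m j k] for one increasing triple, and so for all.  If it
    is smaller, the meets increase along the sequence; if it is larger, they
    decrease; in both cases the gap lies between two of them.  If it is equal,
    all meets are one point [c0].  Then either all terms are [c0], or they lie in
    distinct cones above [c0], and one of the two directions of the circular
    order runs through them. *)
Lemma classification : (forall i j, z i = z j) \/ exists t,
  [/\ forall i0 i1 i i2 i3, lti i0 i1 -> lti i1 i -> lti i i2 -> lti i2 i3 ->
        gap t (z i0) (z i1) (z i2) (z i3) (z i),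
      forall i0 i1 i3, lti i0 i1 -> lti i1 i3 -> gap_marked t (z i0) (z i1) (z i3) &
      forall i0 i1 i2 i3 j0 j1 j2 j3 x, lti i0 i1 -> lti i1 i2 -> lti i2 i3 ->
        lti i3 j0 -> lti j0 j1 -> lti j1 j2 -> lti j2 j3 ->
        gap t (z i0) (z i1) (z i2) (z i3) x ->
        ~ gap t (z j0) (z j1) (z j2) (z j3) x].
Proof.
have le3 i j k i' j' k' : lti i j -> lti j k -> lti i' j' -> lti j' k' ->
    (le (m j k) (m i j) -> le (m j' k') (m i' j')) /\
    (le (m i j) (m j k) -> le (m i' j') (m j' k')).
  move=> ij jk ij' jk'; have [h _] := hz (incr3 ij jk) (incr3 ij' jk').
  by split; [exact: (h (o1, o2) (o0, o1)) | exact: (h (o0, o1) (o1, o2))].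
have [a] := inh; have [b ab] := nomax a; have [c bc] := nomax b.
have [hup|nup] := pselect (le (m b c) (m a b)); last first.
  right; exists Up.
  have up i j k : lti i j -> lti j k -> m i j = m i k /\ lt (m i j) (m j k).
    by move=> ij jk; apply: (meet3 hX) => h; apply: nup; have [/(_ h)] := le3 _ _ _ _ _ _ ij jk ab bc.
  split=> //.
  - move=> i0 i1 i i2 i3 h01 h1 h2 h23 /=; split.
      by rewrite (up _ _ _ h01 h1).1; exact: (meetr hX).
    move=> h; apply: (lt_nle hX (up _ _ _ h2 h23).2); apply: (le_meet hX) => //.
    exact: (meetl hX).
  - move=> i0 i1 i2 i3 j0 j1 j2 j3 x h01 h12 h23 h h01' h12' h23' /= [_ h1] [h2 _].
    apply: h1; apply: (le_trans hX _ h2); rewrite (up _ _ _ h23 h).1.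
    exact: (up _ _ _ (tr h23 h) h01').2.1.
have [hdn|ndn] := pselect (le (m a b) (m b c)); last first.
  right; exists Down.
  have dn i j k : lti i j -> lti j k -> m j k = m i k /\ lt (m j k) (m i j).
    move=> ij jk; rewrite (meetC hX (z j) (z k)) (meetC hX (z i) (z k)) (meetC hX (z i) (z j)).
    apply: (meet3 hX); rewrite (meetC hX (z j) (z i)) (meetC hX (z k) (z j)) => h; apply: ndn.
    by have [_ /(_ h)] := le3 _ _ _ _ _ _ ij jk ab bc.
  split=> //.
  - move=> i0 i1 i i2 i3 h01 h1 h2 h23 /=; split.
      by rewrite (dn _ _ _ h2 h23).1; exact: (meetl hX).
    move=> h; apply: (lt_nle hX (dn _ _ _ h01 h1).2); apply: (le_meet hX) => //.
    exact: (meetr hX).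
  - move=> i0 i1 i2 i3 j0 j1 j2 j3 x h01 h12 h23 h h01' h12' h23' /= [h1 _] [_ h2].
    apply: h2; apply: (le_trans hX _ h1); rewrite (dn _ _ _ h h01').1.
    exact: (dn _ _ _ h23 (tr h h01')).2.1.
have eq2 i j k : lti i j -> lti j k -> m i j = m j k.
  move=> ij jk; have [h1 h2] := le3 _ _ _ _ _ _ ab bc ij jk.
  by apply: (le_anti hX); [exact: h2 | exact: h1].
pose c0 := m a b.
have mc i j : lti i j -> m i j = c0.
  move=> ij; have [k [jk bk]] := common_above j b; have [l kl] := nomax k.
  by rewrite (eq2 _ _ _ ij jk) (eq2 _ _ _ jk kl) -(eq2 _ _ _ bk kl) -(eq2 _ _ _ ab bk).
have le2 i j i' j' : lti i j -> lti i' j' ->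
    (le (z i) (z j) -> le (z i') (z j')) /\ (le (z j) (z i) -> le (z j') (z i')).
  move=> ij ij'; have [k jk] := nomax j; have [k' jk'] := nomax j'.
  have [h _] := hz (incr3 ij jk) (incr3 ij' jk').
  have := (h (o0, o0) (o1, o1), h (o1, o1) (o0, o0)).
  by rewrite /pair_meets /= !(meetxx hX) => -[].
have const : (forall i j, lti i j -> le (z i) (z j)) -> forall i j, z i = z j.
  move=> h; suff hc i : z i = c0 by move=> i j; rewrite !hc.
  have [j ij] := nomax i; rewrite -(mc _ _ ij); apply: (le_anti hX); last exact: (meetl hX).
  by apply: (le_meet hX); [exact: (le_refl hX) | exact: h].
have [h|nle] := pselect (le (z a) (z b)).
  by left; apply: const => i j ij; exact: (le2 _ _ _ _ ab ij).1.
have [h|nge] := pselect (le (z b) (z a)).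
  left; apply: const => i j ij; apply: (le2 _ _ _ _ bc ij).1.
  have zb : z b = c0.
    apply: (le_anti hX); last by rewrite /c0; exact: (meetr hX).
    by apply: (le_meet hX) => //; exact: (le_refl hX).
  by rewrite zb -(mc _ _ bc); exact: (meetr hX).
right.
have c0z i : lt c0 (z i).
  have [j ij] := nomax i; rewrite -(mc _ _ ij); split; first exact: (meetl hX).
  by move=> e; apply: nle; apply: (le2 _ _ _ _ ij ab).1; rewrite -e; exact: (meetr hX).
have ncone i j : lti i j -> ~ same_cone c0 (z i) (z j).
  by move=> ij [_ _]; rewrite mc //; exact: lt_irrefl.
have C3 i j k i' j' k' : lti i j -> lti j k -> lti i' j' -> lti j' k' ->
    (C c0 (z i) (z j) (z k) -> C c0 (z i') (z j') (z k')) /\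
    (C c0 (z k) (z j) (z i) -> C c0 (z k') (z j') (z i')).
  move=> ij jk ij' jk'; have [_ h] := hz (incr3 ij jk) (incr3 ij' jk').
  have := (h (o0, o1) (o0, o0) (o1, o1) (o2, o2), h (o0, o1) (o2, o2) (o1, o1) (o0, o0)).
  by rewrite /pair_meets /= !(meetxx hX) (mc _ _ ij : m i j = _) (mc _ _ ij' : m i' j' = _) => -[].
have disj x p q r s : C c0 p x q -> C c0 r x s -> C c0 p q r -> ~ C c0 p r s.
  move=> pxq rxs pqr prs; have pxr := ct_trans hX pxq pqr.
  by have := C_trans4 hX pxr prs; apply: (C_asym hX).
have [fan|fan] := ct_total hX (c0z a) (c0z b) (c0z c) (ncone _ _ ab) (ncone _ _ bc) (ncone _ _ (tr ab bc)).
  exists Fan.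
  have F i j k : lti i j -> lti j k -> C c0 (z i) (z j) (z k).
    by move=> ij jk; exact: (C3 _ _ _ _ _ _ ab bc ij jk).1.
  split.
  - move=> i0 i1 i i2 i3 h01 h1 h2 h23 /=; rewrite mc //.
    by apply: F; [exact: tr h1 | exact: tr h23].
  - by move=> i0 i1 i3 h01 h13 /=; rewrite mc //; exact: F.
  - move=> i0 i1 i2 i3 j0 j1 j2 j3 x h01 h12 h23 h h01' h12' h23' /=.
    rewrite !mc // => h1 h2; have h03 := tr h01 (tr h12 h23).
    by apply: (disj _ _ _ _ _ h1 h2); apply: F => //; [exact: tr h | exact: tr (tr h12' h23')].
exists FanR.
have F i j k : lti i j -> lti j k -> C c0 (z k) (z j) (z i).
  by move=> ij jk; exact: (C3 _ _ _ _ _ _ ab bc ij jk).2.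
split.
- move=> i0 i1 i i2 i3 h01 h1 h2 h23 /=; rewrite mc //.
  by apply: F; [exact: tr h1 | exact: tr h23].
- by move=> i0 i1 i3 h01 h13 /=; rewrite mc //; exact: F.
- move=> i0 i1 i2 i3 j0 j1 j2 j3 x h01 h12 h23 h h01' h12' h23' /=.
  rewrite !mc // => h1 h2; have h03 := tr h01 (tr h12 h23).
  have h03' := tr h01' (tr h12' h23').
  apply: (disj _ _ _ _ _ h2 h1); apply: F => //; exact: tr h h03'.
Qed.

End Classification.

(** * Terms of a homogeneous sequence are interchangeable *)

Section Block.
Variables (X : structure Lstar) (hX : circ_tree X).
Variables (Q : Type) (U : Q -> X -> Prop) (cs : seq Q).
Variables (I : Type) (Y : finType) (a : I -> Y -> X).

Definition block n (t : 'I_n -> I) (jl : 'I_n * Y) : X := a (t jl.1) jl.2.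

Lemma replace_in_block W (b : W -> X) k i0 i1 i i' i2 i3 :
  ef U cs (k + 5) (block (tnth [tuple i0; i1; i; i2; i3]))
                  (block (tnth [tuple i0; i1; i'; i2; i3])) ->
  (forall l, (a i l = a i0 l /\ a i' l = a i0 l) \/
    exists t, [/\ gap t (a i0 l) (a i1 l) (a i2 l) (a i3 l) (a i l),
                  gap_marked t (a i0 l) (a i1 l) (a i3 l) &
                  forall w, ~ gap t (a i0 l) (a i1 l) (a i2 l) (a i3 l) (b w)]) ->
  ef U cs k (join (a i) b) (join (a i') b).
Proof.
move=> /(ef_meets hX) h hl.
pose s := block (tnth [tuple i0; i1; i2; i3]).
pose o2 : 'I_5 := Ordinal (isT : 2 < 5).
pose f (x : (('I_4 * Y) * ('I_4 * Y)) + Y) : ('I_5 * Y) * ('I_5 * Y) := match x with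
  | inl (p, q) => ((lift o2 p.1, p.2), (lift o2 q.1, q.2))
  | inr l => ((o2, l), (o2, l))
  end.
have skip x (j : 'I_4) : tnth [tuple i0; i1; x; i2; i3] (lift o2 j) = tnth [tuple i0; i1; i2; i3] j.
  by rewrite !(tnth_nth i0) /=; case: j => -[|[|[|[|]]]].
have fE x y : join (pair_meets s) (a x) y =
    pair_meets (block (tnth [tuple i0; i1; x; i2; i3])) (f y).
  case: y => [[p q]|l] /=; last by rewrite /pair_meets (meetxx hX).
  by rewrite /pair_meets /s /block /= !skip.
apply: (ef_replace hX (s := pair_meets s)); first exact: ef_reindex (fE i) (fE i') h.
pose q (j : nat) (hj : j < 4) l : 'I_4 * Y := (Ordinal hj, l).
move=> l; case: (hl l) => [[e e']|[t [hg hm hb]]].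
  left; exists (q 0 isT l, q 0 isT l).
  by rewrite e e' /pair_meets (meetxx hX).
right; exists (regions t (a i0 l) (a i1 l) (a i2 l) (a i3 l)); split=> [D hD|w].
  apply: (@regions_anchored _ hX t _ s (q 0 isT l) (q 1 isT l) (q 2 isT l) (q 3 isT l)) => //.
exact: gap_separates.
Qed.

Lemma block_homogeneous (lti : I -> I -> Prop) k l :
  (forall t t' : 'I_3 -> I, increasing lti t -> increasing lti t' ->
     ef U cs (k + 5) (block t) (block t')) ->
  homogeneous lti (fun i => a i l).
Proof.
move=> h t t' ht ht'; have {}h := ef_meets hX (h t t' ht ht').
pose f (p : 'I_3 * 'I_3) : ('I_3 * Y) * ('I_3 * Y) := ((p.1, l), (p.2, l)).
split; first by move=> p q; apply: (ef_le (x := f p) (y := f q) h).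
by move=> p q r s; apply: (ef_C (x := f p) (y := f q) (z := f r) (w := f s) h).
Qed.

End Block.

Definition nat_lt (i j : nat) : Prop := i < j.

Lemma nat_lt_linear : strict_linear_order nat_lt.
Proof.
split=> [i|i j k|i j]; rewrite /nat_lt; [by rewrite ltnn | exact: ltn_trans |].
by case: (ltngtP i j) => h; [apply: Or31 | apply: Or33 | apply: Or32].
Qed.

Section NIPCore.
Variables (X : structure Lstar) (hX : circ_tree X).
Variables (Q : Type) (U : Q -> X -> Prop) (cs : seq Q).

(** Five indices are used for a block with a term in the middle.  Blocks start at
    the multiples of 6, with two middle terms, of which [S] selects the first. *)
Lemma ef_NIP k p q (Phi : ('I_p + 'I_q -> X) -> Prop)
    (a : nat -> 'I_p -> X) (b : set nat -> 'I_q -> X) :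
  (forall v v', ef U cs k v v' -> Phi v -> Phi v') ->
  ~ forall i S, Phi (join (a i) (b S)) <-> S i.
Proof.
move=> hPhi hab.
have [K [h [hK _]]] : exists (K : finType) (h : ('I_5 * 'I_p -> X) -> K),
    (forall v v', h v = h v' -> ef U cs (k + 5) v v') /\ (forall c : K, True).
  by apply: (@ef_finite_index X Q U cs (fun _ _ => True)).
have [f [c [hf hc]]] := ramsey 5 (fun s => h (block a (fun j : 'I_5 => nth 0 s j))).
pose a' i := a (f i).
have ind5 i0 i1 i2 i3 i4 j0 j1 j2 j3 j4 :
    sorted ltn [:: i0; i1; i2; i3; i4] -> sorted ltn [:: j0; j1; j2; j3; j4] ->
    ef U cs (k + 5) (block a' (tnth [tuple i0; i1; i2; i3; i4]))
                    (block a' (tnth [tuple j0; j1; j2; j3; j4])).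
  have eqb x0 x1 x2 x3 x4 : block a' (tnth [tuple x0; x1; x2; x3; x4]) =
      block a (fun j : 'I_5 => nth 0 (map f [:: x0; x1; x2; x3; x4]) j).
    by apply: funext => -[j l]; rewrite /block /a' /= (tnth_nth 0); case: j => -[|[|[|[|[|]]]]].
  by move=> hi hj; apply: hK; rewrite !eqb !hc.
have homog l : homogeneous nat_lt (fun i => a' i l).
  apply: (@block_homogeneous _ hX _ U cs _ _ a' nat_lt k) => t t' ht ht'.
  pose g (x : 'I_3 * 'I_p) : 'I_5 * 'I_p := (widen_ord (isT : 3 <= 5) x.1, x.2).
  pose o0 : 'I_3 := ord0; pose o1 : 'I_3 := Ordinal (isT : 1 < 3).
  pose o2 : 'I_3 := Ordinal (isT : 2 < 3).
  have tE (u : 'I_3 -> nat) x : block a' u x =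
     block a' (tnth [tuple u o0; u o1; u o2; (u o2).+1; (u o2).+2]) (g x).
    rewrite /block (tnth_nth 0) /=; case: x => -[[|[|[|//]]] hx] l' /=; congr (a' (u _) _);
    exact: val_inj.
  apply: ef_reindex (tE t) (tE t') _; apply: ind5 => /=; apply/and5P; split=> //;
    by [apply: ht | apply: ht'].
have /choice[K' hK'] l : exists o : option kind, match o with
    | None => forall i j, a' i l = a' j l
    | Some t => [/\ forall i0 i1 i i2 i3, nat_lt i0 i1 -> nat_lt i1 i -> nat_lt i i2 -> nat_lt i2 i3 ->
        gap t (a' i0 l) (a' i1 l) (a' i2 l) (a' i3 l) (a' i l),
      forall i0 i1 i3, nat_lt i0 i1 -> nat_lt i1 i3 -> gap_marked t (a' i0 l) (a' i1 l) (a' i3 l) &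
      forall i0 i1 i2 i3 j0 j1 j2 j3 x, nat_lt i0 i1 -> nat_lt i1 i2 -> nat_lt i2 i3 ->
        nat_lt i3 j0 -> nat_lt j0 j1 -> nat_lt j1 j2 -> nat_lt j2 j3 ->
        gap t (a' i0 l) (a' i1 l) (a' i2 l) (a' i3 l) x ->
        ~ gap t (a' j0 l) (a' j1 l) (a' j2 l) (a' j3 l) x]
    end.
  have [] := classification hX nat_lt_linear (fun i => ex_intro _ i.+1 (ltnSn i)) (inhabits 0) (homog l).
    by exists None.
  by move=> [t ht]; exists (Some t).
pose S : set nat := fun i => exists n, i = f (6 * n + 2).
pose bad n (ly : 'I_p * 'I_q) : Prop := if K' ly.1 is Some t then
  gap t (a' (6 * n) ly.1) (a' (6 * n + 1) ly.1) (a' (6 * n + 4) ly.1) (a' (6 * n + 5) ly.1)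
    (b S ly.2) else False.
have [n hn] : exists n, forall ly, ~ bad n ly.
  apply: contrapT => no.
  have /choice[g hg] (n : 'I_(p * q).+1) : exists ly, bad n ly.
    by apply: contrapT => h'; apply: no; exists n => ly hly; apply: h'; exists ly.
  have ginj : injective g.
    have aux (n m : 'I_(p * q).+1) : n < m -> g n <> g m.
      move=> nm e; have := hg n; have := hg m; rewrite -e /bad; have := hK' (g n).1.
      case: (K' _) => [t|//] [_ _ h'] h2 h1.
      by apply: h' h1 h2; rewrite /nat_lt; lia.
    move=> n m e; apply: val_inj; case: (ltngtP n m) => // nm; first by case: (aux _ _ nm).
    by case: (aux _ _ nm).
  by have := leq_card g ginj; rewrite card_prod !card_ord ltnn.
have key : ef U cs k (join (a' (6 * n + 2)) (b S)) (join (a' (6 * n + 3)) (b S)).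
  apply: (replace_in_block hX (i0 := 6 * n) (i1 := 6 * n + 1) (i2 := 6 * n + 4) (i3 := 6 * n + 5)).
    by apply: ind5 => /=; lia.
  move=> l; have := hK' l; have hb y := hn (l, y); rewrite /bad /= in hb.
  case: (K' l) hb => [t|] hb.
    move=> [h1 h2 _]; right; exists t; split=> //; [apply: h1 | apply: h2]; rewrite /nat_lt; lia.
  by move=> h1; left; split; exact: h1.
have : S (f (6 * n + 3)) by apply/hab; apply: hPhi key _; apply/hab; exists n.
move=> [m e]; case: (ltngtP (6 * n + 3) (6 * m + 2)) => [/hf|/hf|]; rewrite ?e ?ltnn //; lia.
Qed.

End NIPCore.

(** * Reducts *)

Section Reducts.
Variables (L : language) (P : Type).

Definition reduct_const (N : structure (with_const L)) : structure L :=
  {| carrier := N;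
     fint := fun f : fsym L => fint N (Some f : fsym (with_const L));
     rint := fun R : rsym L => rint N (R : rsym (with_const L)) |}.

Definition reduct_preds (N : structure (with_preds L P)) : structure L :=
  {| carrier := N;
     fint := fun f : fsym L => fint N (f : fsym (with_preds L P));
     rint := fun R : rsym L => rint N (inl R : rsym (with_preds L P)) |}.

Fixpoint const_term (V : Type) (t : term L V) : term (with_const L) V :=
  match t with
  | Var x => Var _ x
  | App f ts => @App (with_const L) V (Some f) (fun i => const_term (ts i))
  end.

Fixpoint const_formula (V : Type) (phi : formula L V) : formula (with_const L) V :=
  match phi with
  | Bot => Bot _ _
  | Equal t u => Equal (const_term t) (const_term u)
  | Rel R ts => @Rel (with_const L) _ (R : rsym (with_const L)) (fun i => const_term (ts i))
  | Imp phi psi => Imp (const_formula phi) (const_formula psi)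
  | All phi => All (const_formula phi)
  end.

Fixpoint preds_term (V : Type) (t : term L V) : term (with_preds L P) V :=
  match t with
  | Var x => Var _ x
  | App f ts => @App (with_preds L P) V f (fun i => preds_term (ts i))
  end.

Fixpoint preds_formula (V : Type) (phi : formula L V) : formula (with_preds L P) V :=
  match phi with
  | Bot => Bot _ _
  | Equal t u => Equal (preds_term t) (preds_term u)
  | Rel R ts => @Rel (with_preds L P) _ (inl R) (fun i => preds_term (ts i))
  | Imp phi psi => Imp (preds_formula phi) (preds_formula psi)
  | All phi => All (preds_formula phi)
  end.

Lemma eval_const (N : structure (with_const L)) (V : Type) (t : term L V) (v : V -> N) :
  eval v (const_term t) = eval (v : V -> reduct_const N) t.
Proof. by elim: t => [//|f ts IH] /=; congr fint; apply: funext => i; exact: IH. Qed.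

Lemma eval_preds (N : structure (with_preds L P)) (V : Type) (t : term L V) (v : V -> N) :
  eval v (preds_term t) = eval (v : V -> reduct_preds N) t.
Proof. by elim: t => [//|f ts IH] /=; congr fint; apply: funext => i; exact: IH. Qed.

Lemma sat_const (N : structure (with_const L)) (V : Type) (phi : formula L V) (v : V -> N) :
  sat (const_formula phi) v <-> sat phi (v : V -> reduct_const N).
Proof.
elim: phi v => {V} [//|V t u|V R ts|V phi IH1 psi IH2|V phi IH] v /=.
- by rewrite !eval_const.
- by rewrite (_ : (fun i => eval v _) = fun i => eval (v : V -> reduct_const N) (ts i)) //;
    apply: funext => i; rewrite eval_const.
- by split=> h /IH1/h/IH2.
- by split=> h a; apply/IH.
Qed.

Lemma sat_preds (N : structure (with_preds L P)) (V : Type) (phi : formula L V) (v : V -> N) :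
  sat (preds_formula phi) v <-> sat phi (v : V -> reduct_preds N).
Proof.
elim: phi v => {V} [//|V t u|V R ts|V phi IH1 psi IH2|V phi IH] v /=.
- by rewrite !eval_preds.
- by rewrite (_ : (fun i => eval v _) = fun i => eval (v : V -> reduct_preds N) (ts i)) //;
    apply: funext => i; rewrite eval_preds.
- by split=> h /IH1/h/IH2.
- by split=> h a; apply/IH.
Qed.

End Reducts.

(** * Formulas are invariant under back-and-forth equivalence *)

Section EFMore.
Variables (X : structure Lstar) (Q : Type) (U : Q -> X -> Prop).

Lemma ef_sub cs cs' k V (v v' : V -> X) :
  (forall q, List.In q cs -> List.In q cs') -> ef U cs' k v v' -> ef U cs k v v'.
Proof.
move=> hcs; elim: k V v v' => [|k IH] V v v'.
  by case=> h1 h2 h3; split=> // q x /hcs; exact: h3.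
case=> h1 h2 h3; split; first exact: IH.
- by move=> z; have [z' /IH] := h2 z; exists z'.
- by move=> z; have [z' /IH] := h3 z; exists z'.
Qed.

Lemma ef_mono cs j k V (v v' : V -> X) : j <= k -> ef U cs k v v' -> ef U cs j v v'.
Proof.
elim: k => [|k IH]; first by rewrite leqn0 => /eqP ->.
by rewrite leq_eqVlt => /orP[/eqP -> //|/IH h [/h]].
Qed.

End EFMore.

Lemma fun_I2 T (g : 'I_2 -> T) : g = tnth [tuple g ord0; g (Ordinal (isT : 1 < 2))].
Proof.
by apply: funext => -[[|[|//]] hi]; rewrite (tnth_nth (g ord0)) /=; congr g; apply: val_inj.
Qed.

Lemma fun_I4 T (g : 'I_4 -> T) : g = tnth [tuple g ord0; g (Ordinal (isT : 1 < 4));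
  g (Ordinal (isT : 2 < 4)); g (Ordinal (isT : 3 < 4))].
Proof.
by apply: funext => -[[|[|[|[|//]]]] hi]; rewrite (tnth_nth (g ord0)) /=; congr g; apply: val_inj.
Qed.

Section Invariance.
Variables (P : Type) (N : structure (with_preds (with_const Lstar) P)).
Local Notation L := (with_preds (with_const Lstar) P).
Local Notation X := (reduct_const (reduct_preds N)).
Hypothesis hX : circ_tree X.

(** The named constant becomes a colour of one point, which forces duplicator to
    answer it by itself. *)
Definition colour (q : option P) (x : N) : Prop :=
  match q with
  | None => exists ts, x = fint N (None : fsym L) ts
  | Some p => rint N (inr p : rsym L) (fun=> x)
  end.

Local Notation ef cs := (@ef X (option P) colour cs).

(** The value of a term can be added to a game at the price of some rounds,
    whatever else has been played. *)
Definition addable V (t : term L V) := forall cs k, List.In None cs ->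
  exists k', forall W (f : V -> W) (w w' : W -> N), ef cs k' w w' ->
    ef cs k (extend w (eval (w \o f) t)) (extend w' (eval (w' \o f) t)).

Lemma add_terms V n (ts : 'I_n -> term L V) : (forall i, addable (ts i)) ->
  forall cs k, List.In None cs ->
  exists k', forall W (f : V -> W) (w w' : W -> N), ef cs k' w w' ->
    ef cs k (join w (fun i => eval (w \o f) (ts i)))
            (join w' (fun i => eval (w' \o f) (ts i))).
Proof.
elim: n ts => [|n IH] ts hts cs k hcs.
  exists k => W f w w' h; pose g (x : W + 'I_0) : W := match x with
    | inl x => x | inr (Ordinal _ h) => match notF h with end end.
  by apply: (ef_reindex (f := g)) h => -[x|[]].
have [k1 h1] := IH (fun i => ts (lift ord0 i)) (fun i => hts _) cs k hcs.
have [k2 h2] := hts ord0 cs k1 hcs.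
exists k2 => W f w w' /(h2 W f)/(h1 _ (Some \o f)).
pose g (x : W + 'I_n.+1) : option W + 'I_n := match x with
  | inl x => inl (Some x)
  | inr i => if unlift ord0 i is Some j then inr j else inl None
  end.
have gE (u : W -> N) x : join u (fun i => eval (u \o f) (ts i)) x =
    join (extend u (eval (u \o f) (ts ord0)))
      (fun i => eval (extend u (eval (u \o f) (ts ord0)) \o (Some \o f)) (ts (lift ord0 i)))
      (g x).
  by case: x => [x|i] //=; case: unliftP => [j|] ->.
exact: (@ef_reindex X _ colour cs k _ _ g _ _ _ _ (gE w) (gE w')).
Qed.

Lemma term_addable (V : Type) (t : term L V) : addable t.
Proof.
elim: t => [x|f ts IH] cs k hcs.
  exists k => W f w w'; pose g (o : option W) := if o is Some y then y else f x.
  by apply: (ef_reindex (f := g)) => -[].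
case: f ts IH => [[]|] ts IH; last first.
  exists k.+1 => W f w w' [_ /(_ (fint N (None : fsym L) (fun i => eval (w \o f) (ts i))))[z h] _].
  rewrite /= (_ : fint N _ (fun i => eval (w' \o f) (ts i)) = z) //.
  have [_ _ /(_ None None hcs) [c _]] := ef_ef0 h.
  have [|ts' /= ->] := c; first by eexists.
  by congr fint; apply: funext => -[].
have [k' hk'] := add_terms IH k.+2 hcs.
exists k' => W f w w' /(hk' W f) h.
have := ef_meet hX (inr ord0) (inr (Ordinal (isT : 1 < 2))) h.
pose g (o : option W) : option (W + 'I_2) := if o is Some x then Some (inl x) else None.
move=> [+ _ _]; apply: (ef_reindex (f := g)); case=> [x|] //=; congr fint; exact: fun_I2.
Qed.

Lemma formula_invariant (V : Type) (phi : formula L V) : exists cs k, forall v v' : V -> N,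
  ef cs k v v' -> sat phi v -> sat phi v'.
Proof.
elim: phi => {V} [V|V t u|V R ts|V phi IH1 psi IH2|V phi IH].
- by exists [::], 0.
- have hcs : List.In None [:: None : option P] by left.
  have [k2 h2] := term_addable u 0 hcs; have [k1 h1] := term_addable t k2 hcs.
  exists [:: None], k1 => v v' /(h1 V id)/(h2 _ Some) h /= e.
  exact: (ef_eq hX (x := Some None) (y := None) h).
- have hcs q : List.In None [:: None : option P; q] by left.
  case: R ts => [[]|p] ts.
  + have [k h] := add_terms (fun i => term_addable (ts i)) 0 (hcs None).
    exists [:: None; None], k => v v' /(h V id)[hle _ _] /=.
    rewrite [X in rint N _ X -> _]fun_I2 [X in _ -> rint N _ X]fun_I2.
    exact: (hle (inr ord0) (inr (Ordinal (isT : 1 < 2)))).1.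
  + have [k h] := add_terms (fun i => term_addable (ts i)) 0 (hcs None).
    exists [:: None; None], k => v v' /(h V id)[_ hC _] /=.
    rewrite [X in rint N _ X -> _]fun_I4 [X in _ -> rint N _ X]fun_I4.
    exact: (hC (inr ord0) (inr (Ordinal (isT : 1 < 4))) (inr (Ordinal (isT : 2 < 4)))
      (inr (Ordinal (isT : 3 < 4)))).1.
  + have [k h] := term_addable (ts ord0) 0 (hcs (Some p)).
    exists [:: None; Some p], k => v v' /(h V id)[_ _ hU] /=.
    have e (g : 'I_1 -> N) : g = fun=> g ord0 by apply: funext => i; rewrite (ord1 i).
    rewrite [X in rint N _ X -> _]e [X in _ -> rint N _ X]e.
    by apply: (hU (Some p) None _).1; right; left.
- have [cs1 [k1 h1]] := IH1; have [cs2 [k2 h2]] := IH2.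
  exists (List.app cs1 cs2), (maxn k1 k2) => v v' h /= himp h1'.
  apply: (h2 v).
    apply: ef_sub (ef_mono (leq_maxr k1 k2) h) => q hq; apply: List.in_or_app; by right.
  apply: himp; apply: (h1 v') h1'; apply: ef_sym.
  apply: ef_sub (ef_mono (leq_maxl k1 k2) h) => q hq; apply: List.in_or_app; by left.
- have [cs [k h]] := IH; exists cs, k.+1 => v v' [_ _ back] /= hall z'.
  by have [z hz] := back z'; apply: h hz (hall z).
Qed.

Lemma structure_NIP p q (phi : formula L ('I_p + 'I_q)) a b :
  ~ forall (i : nat) (S : set nat), sat phi (join (a i : 'I_p -> N) (b S)) <-> S i.
Proof.
by have [cs [k h]] := formula_invariant phi; exact: (ef_NIP hX h).
Qed.

End Invariance.

(** * The axioms as a first-order sentence *)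

Section Sentences.
Variable V : Type.
Implicit Types (t u x : term Lstar V) (p q : formula Lstar V).

Definition tMeet t u := @App Lstar V Meet (tnth [tuple t; u]).
Definition fLe t u := @Rel Lstar V Le (tnth [tuple t; u]).
Definition fC x t0 t1 t2 := @Rel Lstar V Cstar (tnth [tuple x; t0; t1; t2]).
Definition fNot p := Imp p (Bot Lstar V).
Definition fAnd p q := fNot (Imp p (fNot q)).
Definition fOr p q := Imp (fNot p) q.
Definition fLt t u := fAnd (fLe t u) (fNot (Equal t u)).
Definition fCone x t u := fAnd (fAnd (fLt x t) (fLt x u)) (fLt x (tMeet t u)).

Variables (X : structure Lstar) (v : V -> X).

Lemma eval_meet t u : eval v (tMeet t u) = meet (eval v t) (eval v u).
Proof.
by rewrite /meet /=; congr fint; rewrite [LHS]fun_I2 /= !(tnth_nth t).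
Qed.

Lemma sat_le t u : sat (fLe t u) v = le (eval v t) (eval v u).
Proof.
by rewrite /le /=; congr rint; rewrite [LHS]fun_I2 /= !(tnth_nth t).
Qed.

Lemma sat_C x t0 t1 t2 : sat (fC x t0 t1 t2) v =
  C (eval v x) (eval v t0) (eval v t1) (eval v t2).
Proof.
by rewrite /C /=; congr rint; rewrite [LHS]fun_I4 /= !(tnth_nth x).
Qed.

Lemma sat_imp p q : sat (Imp p q) v = (sat p v -> sat q v). Proof. by []. Qed.

Lemma sat_not p : sat (fNot p) v = ~ sat p v. Proof. by []. Qed.

Lemma sat_and p q : sat (fAnd p q) v = (sat p v /\ sat q v).
Proof.
apply: propext; rewrite sat_not sat_imp sat_not; split=> [|[hp hq] h]; last exact: h.
by move=> /not_implyP[hp /contrapT hq].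
Qed.

Lemma sat_or p q : sat (fOr p q) v = (sat p v \/ sat q v).
Proof.
apply: propext; rewrite sat_imp sat_not; split=> [h|[hp|hq]//].
by have [hp|/h hq] := pselect (sat p v); [left | right].
Qed.

Lemma sat_eq t u : sat (Equal t u) v = (eval v t = eval v u). Proof. by []. Qed.

Lemma sat_lt t u : sat (fLt t u) v = lt (eval v t) (eval v u).
Proof. by rewrite sat_and sat_not sat_le. Qed.

Lemma sat_cone x t u : sat (fCone x t u) v = same_cone (eval v x) (eval v t) (eval v u).
Proof.
rewrite (sat_and (fAnd (fLt x t) (fLt x u))) (sat_and (fLt x t)) !sat_lt eval_meet.
by apply: propext; split=> [[[h1 h2] h3]|[h1 h2 h3]].
Qed.

Definition satE := (eval_meet, sat_cone, sat_lt, sat_le, sat_C, sat_and, sat_or, sat_not, sat_eq, sat_imp).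

End Sentences.

Definition x0 V : term Lstar (option V) := Var Lstar None.
Definition x1 V : term Lstar (option (option V)) := Var Lstar (Some None).
Definition x2 V : term Lstar (option (option (option V))) := Var Lstar (Some (Some None)).
Definition x3 V : term Lstar (option (option (option (option V)))) :=
  Var Lstar (Some (Some (Some None))).
Definition x4 V : term Lstar (option (option (option (option (option V))))) :=
  Var Lstar (Some (Some (Some (Some None)))).
Arguments x0 {V}. Arguments x1 {V}. Arguments x2 {V}. Arguments x3 {V}. Arguments x4 {V}.

Definition axioms : seq (formula Lstar void) := [::
  All (fLe x0 x0);
  All (All (Imp (fLe x1 x0) (Imp (fLe x0 x1) (Equal x1 x0))));
  All (All (All (Imp (fLe x2 x1) (Imp (fLe x1 x0) (fLe x2 x0)))));
  All (All (All (Imp (fLe x1 x2) (Imp (fLe x0 x2) (fOr (fLe x1 x0) (fLe x0 x1))))));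
  All (All (fAnd (fLe (tMeet x1 x0) x1) (fLe (tMeet x1 x0) x0)));
  All (All (All (Imp (fLe x0 x2) (Imp (fLe x0 x1) (fLe x0 (tMeet x2 x1))))));
  All (All (All (All (All (Imp (fCone x4 x3 x2) (Imp (fC x4 x3 x1 x0) (fC x4 x2 x1 x0)))))));
  All (All (All (All (Imp (fC x3 x2 x1 x0) (fLt x3 x2)))));
  All (All (All (All (Imp (fC x3 x2 x1 x0) (fC x3 x1 x0 x2)))));
  All (All (All (All (Imp (fC x3 x2 x1 x0) (fNot (fC x3 x0 x1 x2))))));
  All (All (All (All (All (Imp (fC x4 x3 x2 x1) (Imp (fC x4 x3 x1 x0) (fC x4 x3 x2 x0)))))));
  All (All (All (All (Imp (fLt x3 x2) (Imp (fLt x3 x1) (Imp (fLt x3 x0)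
    (Imp (fNot (fCone x3 x2 x1)) (Imp (fNot (fCone x3 x1 x0)) (Imp (fNot (fCone x3 x2 x0))
      (fOr (fC x3 x2 x1 x0) (fC x3 x0 x1 x2)))))))))))
].

Lemma all_intro (X : structure Lstar) V (phi : formula Lstar (option V)) (v : V -> X)
    (R : X -> Prop) :
  (forall a, sat phi (extend v a) = R a) -> sat (All phi) v = (forall a, R a).
Proof. by move=> h; apply: eq_forall. Qed.

Lemma axiomsP (X : structure Lstar) :
  (forall phi, List.In phi axioms -> holds X phi) <-> circ_tree X.
Proof.
have inP (l : seq (formula Lstar void)) : (forall phi, List.In phi l -> holds X phi) <->
    foldr (fun phi P => holds X phi /\ P) True l.
  elim: l => [|phi l IH] /=; first by split.
  split=> [h|[h1 /IH h2] psi [<-|]] //; last exact: h2.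
  by split; [apply: h; left | apply/IH => psi hp; apply: h; right].
apply: (iff_trans (inP _)) => {inP}.
have -> : foldr (fun phi P => holds X phi /\ P) True axioms = foldr and True [::
    forall x : X, le x x;
    forall x y : X, le x y -> le y x -> x = y;
    forall x y z : X, le x y -> le y z -> le x z;
    forall x y z : X, le y x -> le z x -> le y z \/ le z y;
    forall x y : X, le (meet x y) x /\ le (meet x y) y;
    forall x y z : X, le z x -> le z y -> le z (meet x y);
    forall x a a' b c : X, same_cone x a a' -> C x a b c -> C x a' b c;
    forall x a b c : X, C x a b c -> lt x a;
    forall x a b c : X, C x a b c -> C x b c a;
    forall x a b c : X, C x a b c -> ~ C x c b a;
    forall x a b c d : X, C x a b c -> C x a c d -> C x a b d;
    forall x a b c : X, lt x a -> lt x b -> lt x c ->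
      ~ same_cone x a b -> ~ same_cone x b c -> ~ same_cone x a c ->
      C x a b c \/ C x c b a].
  rewrite /axioms /=; do 12![congr (_ /\ _);
    first by rewrite /holds; do ?(apply: all_intro => ?); rewrite !satE /=].
split=> [[h1 [h2 [h3 [h4 [h5 [h6 [h7 [h8 [h9 [h10 [h11 [h12 _]]]]]]]]]]]]|[[]]].
  split; [by split | exact: h7 | exact: h8 | exact: h9 | exact: h10 | exact: h11 |
    exact: h12].
by move=> *; do 12?[split; first by []].
Qed.

(** * Fraisse limits *)

(** By invariance under [same_cone], the relation on cones and the relation on
    their elements determine each other. *)
Lemma Tstar_circ_tree (A : structure Lstar) : Tstar_forall A -> circ_tree A.
Proof.
move=> [tree inv above circ].
pose K x a : set A := [set b | same_cone x a b].
have KD x a : lt x a -> open_cones x (K x a) by move=> h; exists a.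
have KE x a b : lt x a -> lt x b -> same_cone x a b <-> K x a = K x b.
  move=> xa xb; split=> [h|e]; last first.
    by have : K x b b := cone_refl tree xb; rewrite -e.
  apply/seteqP; split=> y hy.
    exact: (cone_trans tree (cone_sym tree h) hy).
  exact: (cone_trans tree h hy).
have KC x a b c : C x a b c -> C_cones x (K x a) (K x b) (K x c).
  by move=> h; have [xa xb xc] := above _ _ _ _ h; exists a, b, c; split=> //;
    exact: cone_refl.
have CK x a b c : C_cones x (K x a) (K x b) (K x c) -> C x a b c.
  by move=> [a' [b' [c' [ha hb hc /inv]]]]; apply; exact: cone_sym.
split=> //.
- move=> x a a' b c ha h; have [xa xb xc] := above _ _ _ _ h.
  by apply: inv h _ _ _ => //; exact: cone_refl.
- by move=> x a b c /above[].
- move=> x a b c h; have [xa xb xc] := above _ _ _ _ h.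
  by apply/CK/(sco_cyclic (circ x) _ _ _ (KC _ _ _ _ h)); exact: KD.
- move=> x a b c h h'; have [xa xb xc] := above _ _ _ _ h.
  by apply: (sco_asym (circ x) _ _ _ (KC _ _ _ _ h) (KC _ _ _ _ h')); exact: KD.
- move=> x a b c d h h'; have [xa xb xc] := above _ _ _ _ h.
  have [_ _ xd] := above _ _ _ _ h'.
  by apply/CK/(sco_trans (circ x) _ _ _ _ (KC _ _ _ _ h) (KC _ _ _ _ h')); exact: KD.
- move=> x a b c xa xb xc ab bc ac.
  have [|||h|h] := sco_total (circ x) (KD _ _ xa) (KD _ _ xb) (KD _ _ xc).
  + by move/(KE _ _ _ xa xb).
  + by move/(KE _ _ _ xb xc).
  + by move/(KE _ _ _ xa xc).
  + by left; exact: CK.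
  + by right; exact: CK.
Qed.

Section Embeddings.
Variables (A F : structure Lstar) (h : A -> F) (hh : embedding h).

Lemma emb_le x y : le (h x) (h y) = le x y.
Proof.
apply/esym/propext; apply: (iff_trans (emb_rel hh (R := Le) _)).
by rewrite [h \o _]fun_I2 /= !(tnth_nth x).
Qed.

Lemma emb_C x y z w : C (h x) (h y) (h z) (h w) = C x y z w.
Proof.
apply/esym/propext; apply: (iff_trans (emb_rel hh (R := Cstar) _)).
by rewrite [h \o _]fun_I4 /= !(tnth_nth x).
Qed.

Lemma emb_meet x y : meet (h x) (h y) = h (meet x y).
Proof.
rewrite /meet (emb_fun hh (f := Meet)); congr fint.
by rewrite [RHS]fun_I2 /= !(tnth_nth x).
Qed.

Lemma emb_lt x y : lt (h x) (h y) = lt x y.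
Proof.
rewrite /lt emb_le; apply: propext; split=> -[xy n]; split=> // e; apply: n.
  by rewrite e.
exact: (emb_inj hh).
Qed.

Lemma emb_cone x a b : same_cone (h x) (h a) (h b) = same_cone x a b.
Proof. by rewrite /same_cone emb_meet !emb_lt. Qed.

Definition embE := (emb_meet, emb_le, emb_C, emb_lt, emb_cone).

End Embeddings.

Section Generated.
Variables (L : language) (F : structure L) (G : set F).

Definition generated (x : F) : Prop :=
  forall S : set F, G `<=` S -> closed_under_functions S -> S x.

Lemma generated_fint (f : fsym L) (xs : 'I_(farity f) -> {x | generated x}) :
  generated (fint F f (sval \o xs)).
Proof. by move=> S GS hS; apply: (hS) => i; exact: (svalP (xs i)). Qed.

Definition substructure : structure L :=
  {| carrier := {x | generated x};
     fint := fun f xs => exist _ (fint F f (sval \o xs)) (generated_fint xs);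
     rint := fun R xs => rint F R (sval \o xs) |}.

Lemma sub_embedding : @embedding L substructure F sval.
Proof.
split=> // -[x hx] [y hy] /= e; subst y.
by congr exist; exact: Prop_irrelevance.
Qed.

Lemma sub_generated : finite_set G -> finitely_generated substructure.
Proof.
move=> finG; exists ((sval : substructure -> F) @^-1` G).
  by apply: finite_preimage finG => x y _ _; exact: (emb_inj sub_embedding).
move=> S GS hS; apply/seteqP; split=> // -[x hx] _.
have := hx (fun y => exists h : generated y, S (exist _ y h)); case.
- by move=> y Gy; exists (fun S' GS' _ => GS' y Gy); exact: GS.
- move=> f xs hxs.
  have /choice[ys hys] i : exists y : substructure, sval y = xs i /\ S y.
    by have [h hS'] := hxs i; exists (exist _ (xs i) h).
  have -> : xs = sval \o ys by apply: funext => i /=; rewrite (hys i).1.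
  by exists (generated_fint ys); apply: (hS f ys) => i; exact: (hys i).2.
- by move=> h; rewrite (_ : hx = h) //; exact: Prop_irrelevance.
Qed.

End Generated.

(** Each axiom is universal in at most five variables, so it can be checked in
    the substructure generated by their values, which belongs to the age. *)
Lemma fraisse_limit_circ_tree (F : structure Lstar) :
  fraisse_limit finite_models_Tstar_forall F -> circ_tree F.
Proof.
move=> hF.
have local (x a b c d : F) : exists (A : structure Lstar) (h : A -> F) x' a' b' c' d',
    [/\ circ_tree A, embedding h & [/\ x = h x', a = h a', b = h b', c = h c' & d = h d']].
  pose G : set F := [set x; a; b; c; d].
  have inG y : G y -> exists y' : substructure G, y = sval y'.
    by move=> Gy; exists (exist _ y (fun S GS _ => GS y Gy)).
  have [|x' ex] := inG x; first by rewrite /G /=; tauto.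
  have [|a' ea] := inG a; first by rewrite /G /=; tauto.
  have [|b' eb] := inG b; first by rewrite /G /=; tauto.
  have [|c' ec] := inG c; first by rewrite /G /=; tauto.
  have [|d' ed] := inG d; first by rewrite /G /=; tauto.
  exists (substructure G), sval, x', a', b', c', d'; split=> //; last exact: sub_embedding.
  have : age F (substructure G).
    split; last by exists sval; exact: sub_embedding.
    by apply: sub_generated; rewrite !finite_setU; do !split; exact: finite_set1.
  by rewrite (fl_age hF) => -[_]; exact: Tstar_circ_tree.
split; first split.
- move=> x; have [A [h [x' [_ [_ [_ [_ [hA hh [-> _ _ _ _]]]]]]]]] := local x x x x x.
  by rewrite !(embE hh); exact: (le_refl hA).
- move=> x y; have [A [h [x' [y' [_ [_ [_ [hA hh [-> -> _ _ _]]]]]]]]] := local x y x x x.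
  by rewrite !(embE hh) => *; congr h; exact: (le_anti hA).
- move=> x y z; have [A [h [x' [y' [z' [_ [_ [hA hh [-> -> -> _ _]]]]]]]]] := local x y z x x.
  by rewrite !(embE hh); exact: (le_trans hA).
- move=> x y z; have [A [h [x' [y' [z' [_ [_ [hA hh [-> -> -> _ _]]]]]]]]] := local x y z x x.
  by rewrite !(embE hh); exact: (le_linear hA).
- move=> x y; have [A [h [x' [y' [_ [_ [_ [hA hh [-> -> _ _ _]]]]]]]]] := local x y x x x.
  by rewrite !(embE hh); split; [exact: (meetl hA) | exact: (meetr hA)].
- move=> x y z; have [A [h [x' [y' [z' [_ [_ [hA hh [-> -> -> _ _]]]]]]]]] := local x y z x x.
  by rewrite !(embE hh); exact: (le_meet hA).
- move=> x a a' b c; have [A [h [? [? [? [? [? [hA hh [-> -> -> -> ->]]]]]]]]] := local x a a' b c.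
  by rewrite !(embE hh); exact: (C_inv1 hA).
- move=> x a b c; have [A [h [? [? [? [? [? [hA hh [-> -> -> -> _]]]]]]]]] := local x a b c c.
  by rewrite !(embE hh); exact: (ct_above hA).
- move=> x a b c; have [A [h [? [? [? [? [? [hA hh [-> -> -> -> _]]]]]]]]] := local x a b c c.
  by rewrite !(embE hh); exact: (C_rot hA).
- move=> x a b c; have [A [h [? [? [? [? [? [hA hh [-> -> -> -> _]]]]]]]]] := local x a b c c.
  by rewrite !(embE hh); exact: (ct_asym hA).
- move=> x a b c d; have [A [h [? [? [? [? [? [hA hh [-> -> -> -> ->]]]]]]]]] := local x a b c d.
  by rewrite !(embE hh); exact: (ct_trans hA).
- move=> x a b c; have [A [h [? [? [? [? [? [hA hh [-> -> -> -> _]]]]]]]]] := local x a b c c.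
  by rewrite !(embE hh); exact: (ct_total hA).
Qed.

(** * Models of the theory are monadically NIP *)

Lemma models_circ_tree (F M : structure Lstar) :
  circ_tree F -> models M (Th F) -> circ_tree M.
Proof.
by move=> /axiomsP hF hM; apply/axiomsP => phi /hF; exact: hM.
Qed.

Lemma That_circ_tree (M : structure Lstar) (r : M) (N : structure (with_const Lstar)) :
  circ_tree M -> models N (That r) -> circ_tree (reduct_const N).
Proof.
move=> /axiomsP hM hN; apply/axiomsP => phi /hM hphi.
have := hN (const_formula phi); rewrite /holds sat_const; apply.
rewrite /That /Th /= /holds sat_const.
by move: r hphi {hN hM} => r; case: M r => T f R r.
Qed.

Lemma preds_circ_tree P (N : structure (with_const Lstar)) (U : P -> set N)
    (N' : structure (with_preds (with_const Lstar) P)) :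
  circ_tree (reduct_const N) -> models N' (Th (expand_preds U)) ->
  circ_tree (reduct_const (reduct_preds N')).
Proof.
move=> /axiomsP hN hN'; apply/axiomsP => phi /hN hphi.
have := hN' (preds_formula P (const_formula phi)); rewrite /holds sat_preds sat_const; apply.
rewrite /Th /= /holds sat_preds sat_const.
by move: U hphi {hN hN'} => U; case: N U => T f R U.
Qed.

Lemma That_monadically_NIP (M : structure Lstar) (r : M) :
  circ_tree M -> monadically_NIP (That r).
Proof.
move=> hM N hN P U p q phi [N' [hN' [a [b hab]]]].
have hX := preds_circ_tree (That_circ_tree hM hN) hN'.
exact: (structure_NIP hX hab).
Qed.

(* Expand by an empty family of predicates. *)
Lemma monadically_NIP_NIP L (T : theory L) : monadically_NIP T -> NIP T.
Proof.
move=> h p q phi [N [hN [a [b hab]]]].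
pose U : void -> set N := of_void (set N).
apply: (h N hN void U p q (preds_formula void phi)).
exists (expand_preds U); split=> //; exists a, b => i S; rewrite -hab sat_preds.
by case: (N) U a b {hab hN} => T' f R.
Qed.

(** * Distality *)

Lemma gap_ef (X : structure Lstar) (hX : circ_tree X) Q (U : Q -> X -> Prop) cs V
    (v v' : V -> X) t p0 p1 p2 p3 x :
  ef U cs 5 v v' -> gap t (v p0) (v p1) (v p2) (v p3) (v x) ->
  gap t (v' p0) (v' p1) (v' p2) (v' p3) (v' x).
Proof.
move=> /(ef_meets (k := 0) hX) h; have h' := ef_sym h.
have mm (u : V -> X) y : u y = pair_meets u (y, y) by rewrite /pair_meets (meetxx hX).
case: t => /=.
- rewrite (mm v x) (mm v' x) => -[h1 h2]; split.
    exact: (ef_le (x := (p0, p1)) (y := (x, x)) h).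
  by move=> h3; apply: h2; apply: (ef_le (x := (p2, p3)) (y := (x, x)) h').
- rewrite (mm v x) (mm v' x) => -[h1 h2]; split.
    exact: (ef_le (x := (p2, p3)) (y := (x, x)) h).
  by move=> h3; apply: h2; apply: (ef_le (x := (p0, p1)) (y := (x, x)) h').
- have := ef_C (x := (p0, p1)) (y := (p0, p0)) (z := (x, x)) (w := (p3, p3)) h.
  by rewrite /pair_meets /= !(meetxx hX).
- have := ef_C (x := (p0, p1)) (y := (p3, p3)) (z := (x, x)) (w := (p0, p0)) h.
  by rewrite /pair_meets /= !(meetxx hX).
Qed.

Lemma lt_cat_linear (I J : Type) (ltI : I -> I -> Prop) (ltJ : J -> J -> Prop) :
  strict_linear_order ltI -> strict_linear_order ltJ ->
  strict_linear_order (lt_cat ltI ltJ).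
Proof.
move=> hI hJ; split.
- by case=> x; [exact: (slo_irrefl hI) | exact: (slo_irrefl hJ)].
- by case=> x [] y [] z //=; [exact: (slo_trans hI) | exact: (slo_trans hJ)].
- case=> x [] y; [| by apply: Or31 | by apply: Or33 |].
    by case: (slo_total hI x y) => [h|->|h]; [apply: Or31 | apply: Or32 | apply: Or33].
  by case: (slo_total hJ x y) => [h|->|h]; [apply: Or31 | apply: Or32 | apply: Or33].
Qed.

Lemma lt_unit_linear : strict_linear_order lt_unit.
Proof. by split=> // -[] []; apply: Or32. Qed.

Lemma flip_linear (I : Type) (ltI : I -> I -> Prop) :
  strict_linear_order ltI -> strict_linear_order (fun x y => ltI y x).
Proof.
move=> h; split; first exact: (slo_irrefl h).
- by move=> x y z xy yz; exact: (slo_trans h yz xy).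
- by move=> x y; case: (slo_total h y x) => [k|->|k]; [apply: Or31 | apply: Or32 | apply: Or33].
Qed.

Lemma finite_bound (I : Type) (ltI : I -> I -> Prop) n (g : 'I_n -> I) :
  strict_linear_order ltI -> (forall i, exists j, ltI i j) -> inhabited I ->
  exists e, forall k, ltI (g k) e.
Proof.
move=> lin nomax [i0].
suff [e he] : exists e, forall k, k \in enum 'I_n -> ltI (g k) e.
  by exists e => k; apply: he; rewrite mem_enum.
elim: (enum 'I_n) => [|k s [e he]]; first by exists i0.
have [e' [ke' ee']] := common_above lin nomax (g k) e.
exists e' => l; rewrite inE => /orP[/eqP -> //|/he h]; exact: (slo_trans lin h ee').
Qed.

Lemma increasing_tuple (I : Type) (lti : I -> I -> Prop) n (t : n.-tuple I) :
  strict_linear_order lti ->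
  (forall x0 k, k.+1 < n -> lti (nth x0 t k) (nth x0 t k.+1)) ->
  increasing lti (tnth t).
Proof.
move=> lin h k l; have x0 := tnth t k; rewrite !(tnth_nth x0).
move: (ltn_ord l); elim: (val l) => [//|j IH] jn.
rewrite ltnS leq_eqVlt => /orP[/eqP -> |kj]; first exact: h.
exact: (slo_trans lin (IH (ltnW jn) kj) (h _ _ jn)).
Qed.

Section Distal.
Variable N : structure (with_const Lstar).

(* No colours besides the constant. *)
Let no_preds : void -> set N := of_void (set N).
Let X : structure Lstar := reduct_const (reduct_preds (expand_preds no_preds)).
Hypothesis hX : circ_tree X.
Local Notation ef cs := (@ef X (option void) (@colour void (expand_preds no_preds)) cs).

(** Equivalence of finite rank is elementary, since its classes are definable. *)
Lemma elementary_ef cs k (V : finType) (v v' : V -> X) :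
  (forall phi : formula (with_const Lstar) V, sat phi (v : V -> N) -> sat phi (v' : V -> N)) ->
  ef cs k v v'.
Proof.
move=> hv.
pose Def (W : Type) (R : (W -> X) -> Prop) :=
  exists phi : formula (with_const Lstar) W, forall w : W -> N, sat phi w <-> R w.
have [K [h [hK hD]]] : exists (K : finType) (h : (V -> X) -> K),
    (forall v v', h v = h v' -> ef cs k v v') /\ (forall c, Def V (fun v => h v = c)).
  apply: ef_finite_index.
  - by move=> W; exists (Imp (Bot _ _) (Bot _ _)) => w /=; split.
  - by move=> W R [phi hphi]; exists (Imp phi (Bot _ _)) => w /=; rewrite hphi.
  - move=> W R R' [phi hphi] [psi hpsi].
    exists (Imp (Imp phi (Imp psi (Bot _ _))) (Bot _ _)) => w /=; rewrite hphi hpsi.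
    by split=> [h|[h1 h2]]; [apply: contrapT; tauto | apply].
  - move=> W R [phi hphi]; exists (Imp (All (Imp phi (Bot _ _))) (Bot _ _)) => w /=.
    split=> [h|[z hz] h]; last by apply: (h z); apply/hphi.
    by apply: contrapT => no; apply: h => a /hphi ha; apply: no; exists a.
  - move=> W x y; exists (@Rel (with_const Lstar) W Le (tnth [tuple Var _ x; Var _ y])) => w /=.
    by rewrite [X in rint N _ X]fun_I2.
  - move=> W x y z u; exists (@Rel (with_const Lstar) W Cstar
      (tnth [tuple Var _ x; Var _ y; Var _ z; Var _ u])) => w /=.
    by rewrite [X in rint N _ X]fun_I4.
  - move=> W [[]|] x; pose e0 (i : 'I_0) : term (with_const Lstar) W := Var _ x.
    exists (Equal (Var _ x) (@App (with_const Lstar) W None e0)) => w /=.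
    split=> [->|[ts ->]]; first by eexists.
    by congr fint; apply: funext => -[].
apply: hK; have [phi hphi] := hD (h v); apply/esym; apply/hphi.
exact/hv/hphi.
Qed.

Variables (I J : Type) (ltI : I -> I -> Prop) (ltJ : J -> J -> Prop).
Hypothesis dI : dense_without_endpoints ltI.
Hypothesis dJ : dense_without_endpoints ltJ.
Variables (m : nat) (a : I -> 'I_m -> N) (b : 'I_m -> N) (c : J -> 'I_m -> N).
Variable A : set N.

Let K := ((I + unit) + J)%type.
Let ltK : K -> K -> Prop := lt_cat (lt_cat ltI lt_unit) ltJ.
Let s : K -> 'I_m -> X := join (join a (fun _ : unit => b)) c.
Let inK (x : I + J) : K := match x with inl i => inl (inl i) | inr j => inr j end.
Let bK : K := inl (inr tt).

Hypothesis ind0 : indiscernible_over set0 ltK (s : K -> 'I_m -> N).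
Hypothesis indA : indiscernible_over A (lt_cat ltI ltJ) (join a c).

Let linI := dwe_linear dI.
Let linJ := dwe_linear dJ.

Let linK : strict_linear_order ltK.
Proof. by do !apply: lt_cat_linear => //; exact: lt_unit_linear. Qed.

Let nomaxK : forall x : K, exists y, ltK x y.
Proof.
have [j0] := dwe_nonempty dJ.
by move=> [x|j]; [exists (inr j0) | have [j' h] := dwe_no_max dJ j; exists (inr j')].
Qed.

Let inhK : inhabited K. Proof. exact: (inhabits bK). Qed.

Let efK cs k n (t t' : 'I_n -> K) : increasing ltK t -> increasing ltK t' ->
  ef cs k (block s t) (block s t').
Proof.
move=> ht ht'; pose no (i : 'I_0) : N := match i with Ordinal _ h => match notF h with end end.
apply: (@ef_reindex X _ _ cs k _ _ inl (join (block s t) no) (join (block s t') no)) => //.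
apply: elementary_ef => phi.
by have [h _] := @ind0 n 0 phi t t' no ht ht' (fun i => match i with Ordinal _ h => match notF h with end end).
Qed.

Let efA cs k n q (t t' : 'I_n -> I + J) (d : 'I_q -> N) :
  increasing (lt_cat ltI ltJ) t -> increasing (lt_cat ltI ltJ) t' ->
  (forall i, A (d i)) ->
  ef cs k (join (block s (inK \o t)) d) (join (block s (inK \o t')) d).
Proof.
move=> ht ht' hd; apply: elementary_ef => phi; have [+ _] := indA phi ht ht' hd.
have e (u : 'I_n -> I + J) : (fun kl : 'I_n * 'I_m => join a c (u kl.1) kl.2) = block s (inK \o u).
  by apply: funext => -[k' l]; rewrite /block /=; case: (u k').
by rewrite !e.
Qed.

Let lt_inK x y : ltK (inK x) (inK y) <-> lt_cat ltI ltJ x y.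
Proof. by case: x => x; case: y. Qed.

(** A tuple of indices that uses [b] can be moved off [b]: put [e] in place of
    the index of [b], with [e0 < e1 < e] in [I] above the other indices in [I]
    and [e2 < e3] in [J] below the other indices in [J].  No other entry lies in
    a gap of the block [e0], [e1], [e2], [e3]: indiscernibility would put it into
    the gap of a block further out as well, and the two gaps are disjoint. *)
Lemma move_out n q (i : 'I_n -> K) (d : 'I_q -> N) :
  increasing ltK i -> (forall y, A (d y)) ->
  exists2 i0 : 'I_n -> I + J, increasing (lt_cat ltI ltJ) i0 &
    forall cs k, ef cs k (join (block s i) d) (join (block s (inK \o i0)) d).
Proof.
move=> hi hd.
have [[kb ib]|nb] := pselect (exists k, i k = bK); last first.
  have /choice[i0 hi0] k : exists y, i k = inK y.
    case e : (i k) => [[x|[]]|y]; [by exists (inl x) | | by exists (inr y)].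
    by case: nb; exists k.
  have ei : i = inK \o i0 by apply: funext.
  exists i0 => [x y xy|cs k]; last by rewrite -ei; exact: ef_refl.
  by apply/lt_inK; rewrite -!hi0; exact: hi.
have below (k : 'I_n) : k < kb -> exists x, i k = inl (inl x).
  by move=> /hi; rewrite ib; case: (i k) => [[x|[]]|y] //; exists x.
have above (k : 'I_n) : kb < k -> exists y, i k = inr y.
  by move=> /hi; rewrite ib; case: (i k) => [[x|[]]|y] //; exists y.
have [x00] := dwe_nonempty dI; have [y00] := dwe_nonempty dJ.
have [e0 he0] := finite_bound
  (fun k => if i k is inl (inl x) then x else x00) linI (dwe_no_max dI) (dwe_nonempty dI).
have [e4 he4] := finite_bound
  (fun k => if i k is inr y then y else y00) (flip_linear linJ) (dwe_no_min dJ) (dwe_nonempty dJ).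
have [e1 h01] := dwe_no_max dI e0; have [e h1e] := dwe_no_max dI e1.
have [e3 h34] := dwe_no_min dJ e4; have [e2 h23] := dwe_no_min dJ e3.
have trI := slo_trans linI; have trJ := slo_trans linJ.
pose i0 (k : 'I_n) : I + J := if k == kb then inl e else match i k with
  | inl (inl x) => inl x | inl (inr _) => inl e | inr y => inr y end.
have i0N (k : 'I_n) : k <> kb -> inK (i0 k) = i k.
  move=> /eqP nk; rewrite /i0 (negPf nk).
  case ek : (i k) => [[x|[]]|y] //.
  by case: (ltngtP k kb) => [/below[x]|/above[y]|/val_inj/eqP]; rewrite ?(negPf nk) ?ek.
exists i0.
  move=> x y xy; apply/lt_inK.
  have [ex|/eqP nx] := eqVneq x kb.
    subst x; rewrite {1}/i0 eqxx i0N; last by move=> ey; move: xy; rewrite ey ltnn.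
    by have [z ->] := above _ xy.
  have [ey|/eqP ny] := eqVneq y kb; last by rewrite !i0N //; exact: hi.
  subst y; rewrite {2}/i0 eqxx i0N //.
  have [z ez] := below _ xy; rewrite ez /=; have := he0 x; rewrite ez => h.
  exact: trI (trI _ _ _ h h01) h1e.
move=> cs k.
(* The index of [b] is overwritten by [e4], which is as far from the block. *)
pose u (k : 'I_n) : K := if k == kb then inr e4 else i k.
pose w := join (block s u) d.
(* Two blocks far from [b], on its right and on its left. *)
have [f0 g0] := dwe_no_max dJ e4; have [f1 g1] := dwe_no_max dJ f0.
have [f2 g2] := dwe_no_max dJ f1; have [f3 g3] := dwe_no_max dJ f2.
have [f3' g4'] := dwe_no_min dI e0; have [f2' g3'] := dwe_no_min dI f3'.
have [f1' g2'] := dwe_no_min dI f2'; have [f0' g1'] := dwe_no_min dI f1'.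
have key : ef cs k (join (s bK) w) (join (s (inK (inl e))) w).
  apply: (replace_in_block hX (i0 := inK (inl e0)) (i1 := inK (inl e1))
    (i2 := inK (inr e2)) (i3 := inK (inr e3))).
    apply: efK; apply: increasing_tuple => // x0 [|[|[|[|//]]]] //= _.
  move=> l.
  have homog : homogeneous ltK (fun x => s x l).
    by apply: (@block_homogeneous _ hX _ _ cs _ _ s ltK k) => t t'; exact: efK.
  have [const|[t [h1 h2 h3]]] := classification hX linK nomaxK inhK homog.
    by left; split; exact: const.
  right; exists t; split; [exact: h1 | exact: h2 |].
  pose E := inK \o tnth [tuple inl e0; inl e1; inr e2; inr e3].
  pose R := inK \o tnth [tuple inr f0; inr f1; inr f2; inr f3].
  have incE : increasing (lt_cat ltI ltJ) (tnth [tuple inl e0; inl e1; inr e2; inr e3]).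
    by apply: increasing_tuple => //; [exact: lt_cat_linear | move=> x0 [|[|[|[|//]]]]].
  have incR : increasing (lt_cat ltI ltJ) (tnth [tuple inr f0; inr f1; inr f2; inr f3]).
    by apply: increasing_tuple => //; [exact: lt_cat_linear | move=> x0 [|[|[|[|//]]]]].
  pose p (j : nat) (hj : j < 4) : 'I_4 * 'I_m := (Ordinal hj, l).
  pose p5 (j : nat) (hj : j < 5) l' : 'I_5 * 'I_m := (Ordinal hj, l').
  have far z : gap t (s (inK (inl e0)) l) (s (inK (inl e1)) l) (s (inK (inr e2)) l)
      (s (inK (inr e3)) l) z ->
    ~ gap t (s (inK (inr f0)) l) (s (inK (inr f1)) l) (s (inK (inr f2)) l)
      (s (inK (inr f3)) l) z.
    by apply: h3 => //=; exact: trJ g0.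
  case=> [[k' l']|y] /= hg; last first.
    apply: (far _ hg).
    exact: (gap_ef hX (p0 := inl (p 0 isT)) (p1 := inl (p 1 isT)) (p2 := inl (p 2 isT))
       (p3 := inl (p 3 isT)) (x := inr y) (efA cs 5 incE incR hd) hg).
  rewrite /block /= in hg.
  have [[x ux xe]|[y uy ey]] : (exists2 x, u k' = inl (inl x) & ltI x e0) \/
      (exists2 y, u k' = inr y & ltJ e3 y).
    rewrite /u; case: eqP => [_|nk]; first by right; exists e4.
    case ek : (i k') => [[x|[]]|y].
    - by left; exists x => //; have := he0 k'; rewrite ek.
    - by have := i0N _ nk; rewrite ek; case: (i0 k').
    - right; exists y => //; have := he4 k'; rewrite ek; exact: trJ.
  - rewrite ux in hg.
    have inc1 : increasing ltK (tnth [tuple inK (inl x); inK (inl e0); inK (inl e1);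
        inK (inr e2); inK (inr e3)]).
      by apply: increasing_tuple => // x0 [|[|[|[|[|//]]]]].
    have inc2 : increasing ltK (tnth [tuple inK (inl x); inK (inr f0); inK (inr f1);
        inK (inr f2); inK (inr f3)]).
      by apply: increasing_tuple => // x0 [|[|[|[|[|//]]]]].
    apply: (far _ hg).
    exact: (gap_ef hX (p0 := p5 1 isT l) (p1 := p5 2 isT l) (p2 := p5 3 isT l)
      (p3 := p5 4 isT l) (x := p5 0 isT l') (efK [::] 5 inc1 inc2) hg).
  - rewrite uy in hg.
    have inc1 : increasing ltK (tnth [tuple inK (inl e0); inK (inl e1);
        inK (inr e2); inK (inr e3); inK (inr y)]).
      by apply: increasing_tuple => // x0 [|[|[|[|[|//]]]]].
    have inc2 : increasing ltK (tnth [tuple inK (inl f0'); inK (inl f1');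
        inK (inl f2'); inK (inl f3'); inK (inr y)]).
      by apply: increasing_tuple => // x0 [|[|[|[|[|//]]]]].
    have hg' := gap_ef hX (p0 := p5 0 isT l) (p1 := p5 1 isT l) (p2 := p5 2 isT l)
      (p3 := p5 3 isT l) (x := p5 4 isT l') (efK [::] 5 inc1 inc2) hg.
    by apply: (h3 (inK (inl f0')) (inK (inl f1')) (inK (inl f2')) (inK (inl f3'))
      (inK (inl e0)) (inK (inl e1)) (inK (inr e2)) (inK (inr e3)) _ g1' g2' g3' g4' h01
      Logic.I h23 hg' hg).
pose g (z : 'I_n * 'I_m + 'I_q) : 'I_m + ('I_n * 'I_m + 'I_q) := match z with
  | inl (k', l) => if k' == kb then inl l else inr (inl (k', l))
  | inr y => inr (inr y)
  end.
apply: (ef_reindex (f := g)) key.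
  case=> [[k' l]|y] //=; rewrite /block /=; case: eqP => [->|nk] /=; first by rewrite ib.
  by rewrite /w /= /block /= /u; case: eqP.
case=> [[k' l]|y] //=; rewrite /block /=; case: eqP => [->|nk] /=; first by rewrite /i0 eqxx.
by rewrite i0N // /w /= /block /= /u; case: eqP.
Qed.

Lemma indiscernible_through_b : indiscernible_over A ltK (s : K -> 'I_m -> N).
Proof.
move=> n q phi i j d hi hj hd.
have inv (v v' : 'I_n * 'I_m + 'I_q -> N) : (forall cs k, ef cs k v v') ->
    sat phi v <-> sat phi v'.
  move=> h; have [cs [k hphi]] := formula_invariant hX (preds_formula void phi).
  have e (u : 'I_n * 'I_m + 'I_q -> N) : sat (preds_formula void phi)
      (u : _ -> expand_preds no_preds) <-> sat phi u.
    rewrite sat_preds; move: u {h hphi v v'}; rewrite /no_preds.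
    by case: (N) phi => T f R.
  by rewrite -!e; split; apply: hphi => //; apply: ef_sym.
have [i0 hi0 hi0'] := move_out hi hd; have [j0 hj0 hj0'] := move_out hj hd.
rewrite (inv _ _ hi0') (inv _ _ hj0').
by apply: inv => cs k; exact: efA.
Qed.

End Distal.

Lemma That_distal (M : structure Lstar) (r : M) : circ_tree M -> distal (That r).
Proof.
move=> hM; split; first exact/monadically_NIP_NIP/That_monadically_NIP.
move=> N hN I J ltI ltJ dI dJ m a b c A ltK s ind0 indA.
have hX : circ_tree (reduct_const (reduct_preds (expand_preds (of_void (set N))))).
  by apply: (@preds_circ_tree void N (of_void (set N))) => //; exact: That_circ_tree hN.
exact: (indiscernible_through_b hX dI dJ ind0 indA).
Qed.

Theorem corollary6p18 (F : structure Lstar)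
    (hF : fraisse_limit finite_models_Tstar_forall F)
    (M : structure Lstar) (hM : models M (Th F)) (r : M) :
  monadically_NIP (That r) /\ distal (That r).
Proof.
have hC : circ_tree M := models_circ_tree (fraisse_limit_circ_tree hF) hM.
by split; [exact: That_monadically_NIP | exact: That_distal].
Qed.
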